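(* Let $S$ be a qubit with Hamiltonian $H_S=\frac{\Delta}{2}\sigma^z$, $\Delta>0$. For any pair of qubit states $\rho$ and $\rho'$ of $S$ and any $\epsilon,\epsilon'>0$, there exist qubit states $\rho_\epsilon$ and $\rho'_{\epsilon'}$ with $\|\rho_\epsilon-\rho\|_1\le\epsilon$ and $\|\rho'_{\epsilon'}-\rho'\|_1\le\epsilon'$ such that $\rho_\epsilon$ can be transformed to $\rho'_{\epsilon'}$ by a correlating-catalytic translationally invariant operation (CCTIO).
   Context: $\sigma^x,\sigma^y,\sigma^z$ are the Pauli matrices and $\|\cdot\|_1$ is the trace norm. For a quantum system with Hamiltonian $H$ (a self-adjoint operator), a translationally invariant operation (TIO) is a completely positive trace-preserving linear map $\mathcal E$ with $\mathcal E(e^{-iHt}\rho e^{iHt})=e^{-iHt}\mathcal E(\rho)e^{iHt}$ for all states $\rho$ and all $t\in\mathbb R$. A state $\rho$ of $S$ can be transformed to a state $\rho'$ of $S$ by CCTIO if there exist a finite-dimensional auxiliary system $C$ with some Hamiltonian $H_C$, a state $\sigma$ of $C$, and a TIO $\mathcal E$ on $SC$ with respect to the total Hamiltonian $H_S\otimes\mathbb 1+\mathbb 1\otimes H_C$ such that $\mathrm{Tr}_C[\mathcal E(\rho\otimes\sigma)]=\rho'$ and $\mathrm{Tr}_S[\mathcal E(\rho\otimes\sigma)]=\sigma$ (the output may be correlated between $S$ and $C$). *)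

(* Defs.v *)
(* MathComp / MathComp-Analysis; complex numbers are R[i] over R : realType. *)
From HB Require Import structures.
From mathcomp Require Import all_boot all_order all_algebra.
From mathcomp Require Import all_classical all_reals all_analysis.
From mathcomp Require Import complex mxtens.

Set Implicit Arguments.
Unset Strict Implicit.
Unset Printing Implicit Defensive.

Import Order.TTheory GRing.Theory Num.Theory.
Local Open Scope ring_scope.
Local Open Scope complex_scope.

Section Operators.
Context {C : numClosedFieldType}.

Definition adjmx m n (A : 'M[C]_(m, n)) : 'M[C]_(n, m) := map_mx Num.conj A^T.

Definition psdmx n (A : 'M[C]_n) : Prop :=
  A \is hermsymmx /\ forall v : 'cV[C]_n, 0 <= (adjmx v *m A *m v) 0 0.

Definition density n (rho : 'M[C]_n) : Prop := psdmx rho /\ \tr rho = 1.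

(* Functional calculus f(A) = \sum_l f(l) P_l of a normal matrix A, with P_l
   the spectral projections; it carries no meaning when A is not normal. *)
Definition spectral_fun n (f : C -> C) (A : 'M[C]_n) : 'M[C]_n :=
  invmx (spectralmx A) *m diag_mx (map_mx f (spectral_diag A)) *m spectralmx A.

(* ||A||_1 = Tr |A| with |A| = sqrt (A^dagger A). *)
Definition trnorm n (A : 'M[C]_n) : C := \tr (spectral_fun sqrtC (adjmx A *m A)).

(* Row (i, a) of 'M_(m * n), i : 'I_m and a : 'I_n, has index
   mxtens_index (i, a), as in the Kronecker product A *t B. *)
Definition ptrace2 m n (A : 'M[C]_(m * n)) : 'M[C]_m :=
  \matrix_(i, j) \sum_a A (mxtens_index (i, a)) (mxtens_index (j, a)).

Definition ptrace1 m n (A : 'M[C]_(m * n)) : 'M[C]_n :=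
  \matrix_(a, b) \sum_i A (mxtens_index (i, a)) (mxtens_index (i, b)).

Definition tens_block n k (A : 'M[C]_(n * k)) (a b : 'I_k) : 'M[C]_n :=
  \matrix_(i, j) A (mxtens_index (i, a)) (mxtens_index (j, b)).

(* E \otimes id_k, applied to A = \sum_(a, b) (tens_block A a b) *t |a><b|. *)
Definition ampliation n k (E : 'M[C]_n -> 'M[C]_n) (A : 'M[C]_(n * k)) :
    'M[C]_(n * k) :=
  \sum_(a < k) \sum_(b < k) E (tens_block A a b) *t delta_mx a b.

Definition completely_positive n (E : {linear 'M[C]_n -> 'M[C]_n}) : Prop :=
  forall (k : nat) (A : 'M[C]_(n * k)), psdmx A -> psdmx (ampliation E A).

Definition trace_preserving n (E : {linear 'M[C]_n -> 'M[C]_n}) : Prop :=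
  forall A : 'M[C]_n, \tr (E A) = \tr A.

End Operators.

Section Dynamics.
Context {R : realType}.

(* e^(x + i y) = e^x (cos y + i sin y) *)
Definition cexp (z : R[i]) : R[i] :=
  (expR (complex.Re z))%:C
    * (cos (complex.Im z) +i* sin (complex.Im z)).

(* e^(-i H t) for a Hermitian H. *)
Definition evolution n (H : 'M[R[i]]_n) (t : R) : 'M[R[i]]_n :=
  spectral_fun (fun l => cexp (- ('i * l * t%:C))) H.

(* e^(i H t) is written evolution H (- t). *)
Definition covariant n (H : 'M[R[i]]_n)
    (E : {linear 'M[R[i]]_n -> 'M[R[i]]_n}) : Prop :=
  forall (rho : 'M[R[i]]_n) (t : R), density rho ->
    E (evolution H t *m rho *m evolution H (- t)) =
    evolution H t *m E rho *m evolution H (- t).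

Definition TIO n (H : 'M[R[i]]_n) (E : {linear 'M[R[i]]_n -> 'M[R[i]]_n}) :
    Prop :=
  [/\ completely_positive E, trace_preserving E & covariant H E].

Definition total_hamiltonian m n (H1 : 'M[R[i]]_m) (H2 : 'M[R[i]]_n) :
    'M[R[i]]_(m * n) :=
  H1 *t (1%:M : 'M[R[i]]_n) + (1%:M : 'M[R[i]]_m) *t H2.

(* n = 0 is excluded by the existence of the state sigma. *)
Definition CCTIO m (HS : 'M[R[i]]_m) (rho rho' : 'M[R[i]]_m) : Prop :=
  exists (n : nat) (HC sigma : 'M[R[i]]_n)
         (E : {linear 'M[R[i]]_(m * n) -> 'M[R[i]]_(m * n)}),
    [/\ HC \is hermsymmx,
        density sigma,
        TIO (total_hamiltonian HS HC) E,
        ptrace2 (E (rho *t sigma)) = rho' &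
        ptrace1 (E (rho *t sigma)) = sigma].

Definition pauli_z : 'M[R[i]]_2 := \matrix_(i, j) ((i == j)%:R * (-1) ^+ i).

Definition qubit_hamiltonian (Delta : R) : 'M[R[i]]_2 :=
  (Delta / 2)%:C *: pauli_z.

End Dynamics.

(* Main.v *)
(* Idea.  The catalyst is a ladder (a finite phase reference) with a clock.  In
   one step the ladder absorbs the incoming qubit [rho] by a two-outcome
   measurement in a coherent basis, is phase shifted by a small angle depending
   on the outcome, and then emits a fresh qubit whose coherence is that of
   [rho'] times the mean phase factor of the ladder.  The phase of the ladder
   thus performs a random walk on the circle of drift proportional to
   1 - cos(theta) and of much smaller diffusion, so it concentrates at 0
   although it starts uniform.  At the level of the Fourier moments [a v] this
   says that the time averages of [a v] have second differences close to 0; a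
   bounded sequence that is nearly affine is nearly constant, so the average of
   [a 1] is close to [a 0 = 1].  When the clock runs out the catalyst is reset to
   its initial incoherent state.  Hence its evolution is periodic, its time
   average is exactly invariant, and with that state as catalyst the output is
   the time average of the emitted qubits, which is close to [rho']. *)
From HB Require Import structures.
Require Import Defs.
From mathcomp Require Import all_boot all_order all_algebra.
From mathcomp Require Import all_classical all_reals all_analysis.
From mathcomp Require Import complex mxtens.
From mathcomp Require Import ring.

Set Implicit Arguments.
Unset Strict Implicit.
Unset Printing Implicit Defensive.

Import Order.TTheory GRing.Theory Num.Theory.
Local Open Scope ring_scope.
Local Open Scope complex_scope.

(** * Positive semidefinite matrices *)

Section PositiveMatrices.
Context {C : numClosedFieldType}.

Lemma adjmxE m n (A : 'M[C]_(m, n)) i j : adjmx A i j = (A j i)^*%R.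
Proof. by rewrite !mxE. Qed.

Lemma adjmxM m n p (A : 'M[C]_(m, n)) (B : 'M[C]_(n, p)) :
  adjmx (A *m B) = adjmx B *m adjmx A.
Proof. by rewrite /adjmx trmx_mul map_mxM. Qed.

Lemma adjmxK m n (A : 'M[C]_(m, n)) : adjmx (adjmx A) = A.
Proof. by apply/matrixP=> i j; rewrite !mxE conjCK. Qed.

Lemma adjmxD m n (A B : 'M[C]_(m, n)) : adjmx (A + B) = adjmx A + adjmx B.
Proof. by rewrite /adjmx linearD map_mxD. Qed.

Lemma hermP n (A : 'M[C]_n) : reflect (adjmx A = A) (A \is hermsymmx).
Proof.
apply: (iffP (is_hermitianmxP _ _ _)); rewrite expr0 scale1r.
  by move=> {2}->.
by move=> {1}<-.
Qed.

Lemma psdmx_congr m n (A : 'M[C]_n) (M : 'M[C]_(m, n)) :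
  psdmx A -> psdmx (M *m A *m adjmx M).
Proof.
move=> [/hermP hA pA]; split.
  by apply/hermP; rewrite !adjmxM adjmxK hA mulmxA.
move=> v; have := pA (adjmx M *m v).
by rewrite adjmxM adjmxK !mulmxA.
Qed.

Lemma psdmx0 n : psdmx (0 : 'M[C]_n).
Proof.
split; first by apply/hermP; apply/matrixP=> i j; rewrite !mxE conjC0.
by move=> v; rewrite mulmx0 mul0mx mxE.
Qed.

Lemma psdmxD n (A B : 'M[C]_n) : psdmx A -> psdmx B -> psdmx (A + B).
Proof.
move=> [/hermP hA pA] [/hermP hB pB]; split.
  by apply/hermP; rewrite adjmxD hA hB.
by move=> v; rewrite mulmxDr mulmxDl mxE addr_ge0.
Qed.

Lemma psdmx_sum (I : finType) n (F : I -> 'M[C]_n) :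
  (forall i, psdmx (F i)) -> psdmx (\sum_i F i).
Proof.
by move=> hF; apply: big_ind => //; [exact: psdmx0 | exact: psdmxD].
Qed.

Lemma psdmxZ n (c : C) (A : 'M[C]_n) : 0 <= c -> psdmx A -> psdmx (c *: A).
Proof.
move=> c0 [/hermP hA pA]; split.
  apply/hermP/matrixP=> i j; rewrite !mxE rmorphM /= -[in RHS]hA !mxE.
  by rewrite (CrealP (ger0_real c0)).
by move=> v; rewrite -scalemxAr -scalemxAl mxE mulr_ge0.
Qed.

Lemma psdmx1 n : psdmx (1%:M : 'M[C]_n).
Proof.
split; first by apply/hermP/matrixP=> i j; rewrite !mxE conjC_nat eq_sym.
move=> v; rewrite mulmx1 mxE sumr_ge0 // => i _.
by rewrite adjmxE mulrC mul_conjC_ge0.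
Qed.

Lemma psdmx_gram m n (A : 'M[C]_(m, n)) : psdmx (A *m adjmx A).
Proof. by rewrite -[A in A *m _]mulmx1; apply/psdmx_congr/psdmx1. Qed.

Lemma sum_quad n (A : 'M[C]_n) (v : 'cV[C]_n) :
  (adjmx v *m A *m v) 0 0 = \sum_i \sum_j (v i 0)^*%R * A i j * v j 0.
Proof.
rewrite mxE exchange_big /=; apply: eq_bigr => j _.
rewrite mxE mulr_suml; apply: eq_bigr => i _.
by rewrite adjmxE.
Qed.

Lemma psdmx_diag_ge0 n (A : 'M[C]_n) i : psdmx A -> 0 <= A i i.
Proof.
move=> [_ /(_ (delta_mx i 0))]; rewrite sum_quad.
rewrite (bigD1 i) //= [X in _ + X]big1 ?addr0 => [|k /negPf nk]; last first.
  by rewrite big1 // => j _; rewrite !mxE nk conjC0 !mul0r.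
rewrite (bigD1 i) //= [X in _ + X]big1 ?addr0 => [|k /negPf nk]; last first.
  by rewrite !mxE nk mulr0.
by rewrite !mxE !eqxx /= conjC1 mul1r mulr1.
Qed.

Lemma spectral_factor n (A : 'M[C]_n) : adjmx A = A ->
  A = adjmx (spectralmx A) *m diag_mx (spectral_diag A) *m spectralmx A.
Proof.
move=> /hermP /hermitian_normalmx /orthomx_spectralP {1}->.
by rewrite (invmx_unitary (spectral_unitarymx A)).
Qed.

Lemma spectral_diag_ge0 n (A : 'M[C]_n) i : psdmx A -> 0 <= spectral_diag A 0 i.
Proof.
move=> pA; have [/hermP hA _] := pA.
suff -> : spectral_diag A 0 i =
    (spectralmx A *m A *m adjmx (spectralmx A)) i i.
  exact/psdmx_diag_ge0/psdmx_congr.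
have /unitarymxP U1 : spectralmx A \is unitarymx := spectral_unitarymx A.
rewrite {3}(spectral_factor hA) !mulmxA -[adjmx _]/((spectralmx A) ^t* )%sesqui.
by rewrite U1 mul1mx -mulmxA U1 mulmx1 !mxE eqxx mulr1n.
Qed.

(** Take square roots of the eigenvalues. The factor of a target state later serves to build the
    Kraus operators that emit it. *)
Lemma psdmx_factor n (A : 'M[C]_n) : psdmx A ->
  exists B : 'M[C]_n, A = B *m adjmx B.
Proof.
move=> pA; have [/hermP hA _] := pA.
pose S := diag_mx (map_mx sqrtC (spectral_diag A)).
exists (adjmx (spectralmx A) *m S); rewrite adjmxM adjmxK.
suff SS : S *m adjmx S = diag_mx (spectral_diag A).
  by rewrite mulmxA -(mulmxA _ S) SS -spectral_factor.
apply/matrixP=> i j; rewrite mul_diag_mx !mxE eq_sym.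
case: eqP => [->|_]; last by rewrite !mulr0n conjC0 mulr0.
rewrite !mulr1n (CrealP _) ?ger0_real ?sqrtC_ge0 ?spectral_diag_ge0 //.
by rewrite -expr2 sqrtCK.
Qed.

(** Positivity is tested on [e_i - u e_j], with the unit phase [u] chosen so that both cross terms
    equal [-|A i j|]. *)
Lemma psdmx_normr_le n (A : 'M[C]_n) i j : psdmx A ->
  `|A i j| <= (A i i + A j j) / 2.
Proof.
move=> pA; have [->|nij] := eqVneq i j.
  rewrite ger0_norm ?psdmx_diag_ge0 //.
  by rewrite -mulr2n -(mulr_natr (A j j)) mulfK ?pnatr_eq0.
have [/hermP hA _] := pA.
have hji : A j i = (A i j)^*%R by rewrite -[in LHS]hA adjmxE.
have [a0|a0] := eqVneq (A i j) 0.
  by rewrite a0 normr0 divr_ge0 ?addr_ge0 ?psdmx_diag_ge0.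
pose u := (A i j)^*%R / `|A i j|.
have uA : u * A i j = `|A i j|.
  by rewrite /u mulrAC -normCKC expr2 mulfK ?normr_eq0.
have u1 : u * u^*%R = 1.
  rewrite -normCK /u normrM normfV norm_conjC normr_id divff ?expr1n //.
  by rewrite normr_eq0.
have pick k (f : 'I_n -> C) : \sum_l f l * (l == k)%:R = f k.
  rewrite (bigD1 k) //= eqxx mulr1 big1 ?addr0 // => l /negPf ->.
  by rewrite mulr0.
pose v k : C := (k == i)%:R - u * (k == j)%:R.
have lin f : \sum_l f l * v l = f i - u * f j.
  rewrite -(pick i f) -(pick j f) mulr_sumr -sumrB; apply: eq_bigr => l _.
  by rewrite mulrBr [u * (_ * _)]mulrCA.
have linC f : \sum_l (v l)^*%R * f l = f i - u^*%R * f j.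
  rewrite -(pick i f) -(pick j f) mulr_sumr -sumrB; apply: eq_bigr => l _.
  by rewrite rmorphB rmorphM !rmorph_nat /= mulrC mulrBr [u^*%R * (_ * _)]mulrCA.
case: pA => _ /(_ (\col_k v k)); rewrite sum_quad.
have -> : \sum_k \sum_l ((\col_k v k) k (0 : 'I_1))^*%R * A k l
    * (\col_k v k) l (0 : 'I_1) = A i i + A j j - `|A i j| * 2.
  transitivity (\sum_k (v k)^*%R * (A k i - u * A k j)).
    apply: eq_bigr => k _; rewrite -lin mulr_sumr; apply: eq_bigr => l _.
    by rewrite !mxE mulrA.
  rewrite linC uA mulrBr mulrA [u^*%R * u]mulrC u1 mul1r hji -rmorphM /= uA conj_normC.
  by rewrite opprB mulr_natr mulr2n opprD addrACA.
by rewrite subr_ge0 ler_pdivlMr ?ltr0n.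
Qed.

End PositiveMatrices.

(** * Trace norm against entries *)

Section TraceNorm.
Context {C : numClosedFieldType}.

Lemma mxtrace_spectral_fun n (f : C -> C) (A : 'M[C]_n) :
  \tr (spectral_fun f A) = \sum_i f (spectral_diag A 0 i).
Proof.
rewrite /spectral_fun -mulmxA mxtrace_mulC mulmxK ?spectral_unit //.
by rewrite mxtrace_diag; apply: eq_bigr => i _; rewrite mxE.
Qed.

(** Each eigenvalue of [adjmx A *m A] is at most its trace, a sum of [n ^ 2] squared moduli of
    entries, so each of the [n] singular values is at most [n e]. Closeness of states can thus be
    checked entrywise. *)
Lemma trnorm_le n (A : 'M[C]_n) (e : C) : 0 <= e ->
  (forall i j, `|A i j| <= e) -> trnorm A <= n%:R ^+ 2 * e.
Proof.
move=> e0 hA; have pAA : psdmx (adjmx A *m A).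
  by have := psdmx_gram (adjmx A); rewrite adjmxK.
have [/hermP hAA _] := pAA.
have d0 i := spectral_diag_ge0 i pAA.
have sumd : \sum_i spectral_diag (adjmx A *m A) 0 i = \tr (adjmx A *m A).
  rewrite [in RHS](spectral_factor hAA).
  rewrite -[adjmx _ in RHS](invmx_unitary (spectral_unitarymx _)).
  by rewrite -mulmxA mxtrace_mulC mulmxK ?spectral_unit // mxtrace_diag.
have ne0 : 0 <= n%:R * e by rewrite mulr_ge0.
have trle : \tr (adjmx A *m A) <= (n%:R * e) ^+ 2.
  rewrite /mxtrace; have -> : (n%:R * e) ^+ 2 = \sum_(i < n) \sum_(j < n) e ^+ 2.
    by rewrite !sumr_const card_ord -mulrnA exprMn -natrX mulr_natl mulnn.
  apply: ler_sum => i _; rewrite mxE; apply: ler_sum => j _.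
  by rewrite adjmxE -normCKC ler_pXn2r ?nnegrE.
rewrite /trnorm mxtrace_spectral_fun expr2 -mulrA.
have -> : n%:R * (n%:R * e) = \sum_(i < n) n%:R * e.
  by rewrite sumr_const card_ord mulr_natl.
apply: ler_sum => i _.
rewrite -(sqrCK ne0) ler_sqrtC ?nnegrE ?exprn_ge0 //.
apply: le_trans trle; rewrite -sumd (bigD1 i) //= lerDl.
by apply: sumr_ge0.
Qed.

End TraceNorm.

(** * Maps in Kraus form *)

Section Kraus.
Context {C : numClosedFieldType} (I : finType) (n : nat) (K : I -> 'M[C]_n).

Definition kraus (X : 'M[C]_n) : 'M[C]_n := \sum_i K i *m X *m adjmx (K i).

Fact kraus_is_linear : linear kraus.
Proof.
move=> a X Y; rewrite /kraus scaler_sumr -big_split /=; apply: eq_bigr => i _.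
by rewrite mulmxDr mulmxDl -scalemxAr -scalemxAl.
Qed.

HB.instance Definition _ := GRing.isLinear.Build C 'M[C]_n 'M[C]_n _ kraus
  kraus_is_linear.

Lemma krausE (X : 'M[C]_n) y y' :
  kraus X y y' = \sum_i \sum_x \sum_x' K i y x * X x x' * (K i y' x')^*%R.
Proof.
rewrite /kraus summxE; apply: eq_bigr => i _; rewrite mxE exchange_big /=.
apply: eq_bigr => x _; rewrite mxE mulr_suml; apply: eq_bigr => x' _.
by rewrite adjmxE.
Qed.

Lemma kraus_psd (X : 'M[C]_n) : psdmx X -> psdmx (kraus X).
Proof. by move=> pX; apply: psdmx_sum => i; apply: psdmx_congr. Qed.

Lemma tens_block_decomp k (A : 'M[C]_(n * k)) :
  A = \sum_(a < k) \sum_(b < k) tens_block A a b *t delta_mx a b.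
Proof.
apply/matrixP=> x y; case: (mxtens_indexP x) => i a; case: (mxtens_indexP y) => j b.
rewrite summxE (bigD1 a) //= summxE (bigD1 b) //= tensmxE !mxE !eqxx mulr1.
rewrite !big1 ?addr0 // => [c /negPf ca|c /negPf cb].
  rewrite summxE big1 // => d _.
  by rewrite tensmxE !mxE eq_sym ca mulr0.
by rewrite tensmxE !mxE [b == c]eq_sym cb andbF mulr0.
Qed.

(** The ampliation is again a Kraus sum, with operators [K i *t 1]; the block decomposition of [A]
    reduces this to simple tensors. *)
Lemma kraus_completely_positive : completely_positive kraus.
Proof.
move=> k A pA.
pose K1 i : 'M[C]_(n * k) := K i *t 1%:M.
suff -> : ampliation kraus A = \sum_i K1 i *m A *m adjmx (K1 i).
  by apply: psdmx_sum => i; apply: psdmx_congr.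
rewrite {2}[A]tens_block_decomp /ampliation.
under [RHS]eq_bigr => i _ do rewrite mulmx_sumr mulmx_suml.
rewrite [RHS]exchange_big /=; apply: eq_bigr => a _.
under [RHS]eq_bigr => i _ do rewrite mulmx_sumr mulmx_suml.
rewrite [RHS]exchange_big /=; apply: eq_bigr => b _.
rewrite /kraus.
have adj i : adjmx (K1 i) = adjmx (K i) *t 1%:M.
  apply/matrixP=> x y; case: (mxtens_indexP x) => p c.
  case: (mxtens_indexP y) => q d.
  by rewrite adjmxE !tensmxE adjmxE rmorphM !mxE rmorph_nat eq_sym.
under [RHS]eq_bigr => i _ do rewrite adj /K1 !tensmx_mul mul1mx mulmx1.
by apply: (big_morph (fun X => X *t delta_mx a b)) => [X Y|];
  [apply/matrixP=> x y; rewrite !mxE mulrDl | rewrite tens0mx].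
Qed.

Lemma kraus_trace_preserving :
  \sum_i adjmx (K i) *m K i = 1%:M -> trace_preserving kraus.
Proof.
move=> hK A; rewrite /kraus raddf_sum /=.
under eq_bigr => i _ do rewrite mxtrace_mulC mulmxA.
by rewrite -(raddf_sum (@mxtrace C n)) -mulmx_suml hK mul1mx.
Qed.

Lemma kraus_density (X : 'M[C]_n) : trace_preserving kraus ->
  density X -> density (kraus X).
Proof. by move=> hK [pX tX]; split; [exact: kraus_psd | rewrite hK]. Qed.

End Kraus.

(** * States under tensor products, partial traces and averages *)

Section TensorStates.
Context {C : numClosedFieldType}.

Lemma sum_mxtens (V : nmodType) m n (f : 'I_(m * n) -> V) :
  \sum_x f x = \sum_s \sum_p f (mxtens_index (s, p)).
Proof.
rewrite pair_big /= (reindex (@mxtens_index m n)) /=.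
  by apply: eq_bigr => -[].
exists (@mxtens_unindex m n) => x _; [exact: mxtens_indexK | exact: mxtens_unindexK].
Qed.

Lemma mxtrace_tens m n (A : 'M[C]_m) (B : 'M[C]_n) : \tr (A *t B) = \tr A * \tr B.
Proof.
rewrite /mxtrace sum_mxtens mulr_suml; apply: eq_bigr => i _.
by rewrite mulr_sumr; apply: eq_bigr => j _; rewrite tensmxE.
Qed.

Lemma adjmx_tens m n p q (A : 'M[C]_(m, n)) (B : 'M[C]_(p, q)) :
  adjmx (A *t B) = adjmx A *t adjmx B.
Proof. by rewrite /adjmx trmx_tens map_mxT. Qed.

Lemma density_tens m n (A : 'M[C]_m) (B : 'M[C]_n) :
  density A -> density B -> density (A *t B).
Proof.
move=> [/psdmx_factor[A1 ->] tA] [/psdmx_factor[B1 ->] tB].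
split; last by rewrite mxtrace_tens tA tB mulr1.
by rewrite -tensmx_mul -adjmx_tens; apply: psdmx_gram.
Qed.

(** A partial trace is a sum of congruences by rectangular matrices [V i], each contracting the
    traced factor with a basis vector. *)
Lemma density_ptrace1 m n (A : 'M[C]_(m * n)) : density A -> density (ptrace1 A).
Proof.
move=> [pA tA]; split; last first.
  rewrite -tA /mxtrace sum_mxtens exchange_big; apply: eq_bigr => p _.
  by rewrite mxE.
pose V (i : 'I_m) : 'M[C]_(n, m * n) :=
  \matrix_(a, x) (x == mxtens_index (i, a))%:R.
suff -> : ptrace1 A = \sum_i V i *m A *m adjmx (V i).
  by apply: psdmx_sum => i; apply: psdmx_congr.
apply/matrixP=> a b; rewrite mxE summxE; apply: eq_bigr => i _.
rewrite mxE (bigD1 (mxtens_index (i, b))) //= big1 ?addr0 => [|y /negPf yb]; last first.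
  by rewrite !mxE yb conjC0 mulr0.
rewrite mxE (bigD1 (mxtens_index (i, a))) //= big1 ?addr0 => [|y /negPf ya]; last first.
  by rewrite !mxE ya mul0r.
by rewrite !mxE !eqxx conjC1 mul1r mulr1.
Qed.

Lemma density_ptrace2 m n (A : 'M[C]_(m * n)) : density A -> density (ptrace2 A).
Proof.
move=> [pA tA]; split; last first.
  by rewrite -tA /mxtrace sum_mxtens; apply: eq_bigr => p _; rewrite mxE.
pose V (a : 'I_n) : 'M[C]_(m, m * n) :=
  \matrix_(i, x) (x == mxtens_index (i, a))%:R.
suff -> : ptrace2 A = \sum_i V i *m A *m adjmx (V i).
  by apply: psdmx_sum => i; apply: psdmx_congr.
apply/matrixP=> i j; rewrite mxE summxE; apply: eq_bigr => a _.
rewrite mxE (bigD1 (mxtens_index (j, a))) //= big1 ?addr0 => [|y /negPf yb]; last first.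
  by rewrite !mxE yb conjC0 mulr0.
rewrite mxE (bigD1 (mxtens_index (i, a))) //= big1 ?addr0 => [|y /negPf ya]; last first.
  by rewrite !mxE ya mul0r.
by rewrite !mxE !eqxx conjC1 mul1r mulr1.
Qed.

Lemma density_delta n (i : 'I_n) : density (delta_mx i i : 'M[C]_n).
Proof.
split; last first.
  rewrite /mxtrace (bigD1 i) //= big1 ?addr0 ?mxE ?eqxx // => j /negPf ji.
  by rewrite mxE ji.
have -> : delta_mx i i = delta_mx i i *m adjmx (delta_mx i i : 'M[C]_n).
  apply/matrixP=> a b; rewrite [RHS]mxE (bigD1 i) //= big1 ?addr0 => [|j /negPf ji].
    by rewrite !mxE !eqxx !andbT rmorph_nat -natrM mulnb.
  by rewrite !mxE ji andbF mul0r.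
exact: psdmx_gram.
Qed.

Lemma density_mean n k (S : 'I_k.+1 -> 'M[C]_n) : (forall i, density (S i)) ->
  density (k.+1%:R^-1 *: \sum_i S i).
Proof.
move=> hS; split.
  by apply: psdmxZ; [rewrite invr_ge0 | apply: psdmx_sum => i; case: (hS i)].
rewrite linearZ /= raddf_sum /=.
under eq_bigr do rewrite (proj2 (hS _)).
by rewrite sumr_const card_ord mulVf // pnatr_eq0.
Qed.

Lemma density_normr_le1 n (A : 'M[C]_n) i j : density A -> `|A i j| <= 1.
Proof.
move=> [pA tA]; apply: le_trans (psdmx_normr_le i j pA) _.
have d k : A k k <= 1.
  by rewrite -tA /mxtrace (bigD1 k) //= lerDl sumr_ge0 // => l _; apply: psdmx_diag_ge0.
by rewrite ler_pdivrMr ?ltr0n // mul1r [2]mulr2n lerD.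
Qed.

End TensorStates.

(** * Nearly affine sequences and small rotations *)

Section PhaseDynamics.
Context {C : numClosedFieldType}.

(** Summing the second differences once controls the variation of the slopes [d v]; summing twice
    compares [x V - x 0] with [V] times the initial slope. Since [x] is bounded, that slope is
    small. *)
Lemma almost_harmonic (x : nat -> C) (b eta : C) (V : nat) :
  (forall v, `|x v| <= b) ->
  (forall v, (v < V)%N -> `|x v.+2 - x v.+1 *+ 2 + x v| <= eta) ->
  V%:R * `|x 1 - x 0| <= b *+ 2 + V%:R ^+ 2 * eta.
Proof.
move=> xb x2; pose d v := x v.+1 - x v.
have dV v : (v <= V)%N -> `|d v - d 0| <= v%:R * eta.
  elim: v => [_|v IH vV]; first by rewrite subrr normr0 mul0r.
  have -> : d v.+1 - d 0 = (x v.+2 - x v.+1 *+ 2 + x v) + (d v - d 0).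
    by rewrite /d; ring.
  rewrite -natr1 mulrDl mul1r addrC [leRHS]addrC.
  by rewrite (le_trans (ler_normD _ _)) // addrC lerD ?x2 ?IH // ltnW.
have eta0 : (0 < V)%N -> 0 <= eta by move=> /x2; apply: le_trans.
have xV v : (v <= V)%N -> `|x v - x 0 - v%:R * d 0| <= v%:R * (V%:R * eta).
  elim: v => [_|v IH vV]; first by rewrite mul0r !subrr normr0 mul0r.
  have -> : x v.+1 - x 0 - v.+1%:R * d 0 =
      (x v - x 0 - v%:R * d 0) + (d v - d 0).
    by rewrite -natr1 /d; ring.
  rewrite -[v.+1%:R]natr1 mulrDl mul1r (le_trans (ler_normD _ _)) // lerD ?IH ?(ltnW vV) //.
  rewrite (le_trans (dV _ (ltnW vV))) // ler_wpM2r ?ler_nat ?(ltnW vV) //.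
  by rewrite eta0 // (leq_trans _ vV).
have -> : V%:R * `|x 1 - x 0| =
   `|(x V - x 0) - (x V - x 0 - V%:R * d 0)|.
  by rewrite subKr normrM normr_nat.
rewrite (le_trans (ler_normB _ _)) // expr2 -mulrA lerD ?xV //.
by rewrite (le_trans (ler_normB _ _)) // mulr2n lerD.
Qed.

(** The error for [v.+1] is [w] times the error for [v] plus [v (w - 1) ^ 2]. *)
Lemma expr_linear_approx (w : C) v : `|w| <= 1 ->
  `|w ^+ v - 1 - v%:R * (w - 1)| <= v%:R ^+ 2 * `|w - 1| ^+ 2.
Proof.
move=> w1; elim: v => [|v IH].
  by rewrite expr0 mul0r !subrr normr0 expr0n mul0r.
have -> : w ^+ v.+1 - 1 - v.+1%:R * (w - 1) =
   w * (w ^+ v - 1 - v%:R * (w - 1)) + v%:R * (w - 1) ^+ 2.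
  by rewrite exprS -natr1; ring.
rewrite (le_trans (ler_normD _ _)) // (normrM w) (normrM v%:R) normrX normr_nat.
rewrite (@le_trans _ _ ((v%:R ^+ 2 + v%:R) * `|w - 1| ^+ 2)) //.
  rewrite mulrDl lerD // (le_trans _ IH) // -[leRHS]mul1r ler_wpM2r //.
rewrite ler_wpM2r ?exprn_ge0 //.
rewrite -natr1 sqrrD1 -addrA lerD2l mulr2n -addrA lerDl addr_ge0 //.
Qed.

(* A phase factor of argument close to [b], rational in [b] (Cayley). *)
Definition cayley (b : C) : C := (1 + 'i%R * b / 2) / (1 - 'i%R * b / 2).

Lemma cayley_den (b : C) : b \is Num.real -> 1 <= `|1 - 'i%R * b / 2|.
Proof.
move=> br; have b2 : b / 2 \is Num.real by rewrite rpredM ?rpredV ?realn.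
rewrite -mulrA -mulrN -(@ler_pXn2r _ 2) ?nnegrE // expr1n normC2_rect ?rpredN //.
by rewrite expr1n lerDl sqrrN real_exprn_even_ge0.
Qed.

Lemma cayley_norm (b : C) : b \is Num.real -> `|cayley b| = 1.
Proof.
move=> br; have b2 : b / 2 \is Num.real by rewrite rpredM ?rpredV ?realn.
have d0 : `|1 - 'i%R * b / 2| != 0.
  by rewrite gt_eqF // (lt_le_trans ltr01) ?cayley_den.
rewrite normrM normfV; apply/eqP; rewrite -(inj_eq (mulIf d0)) mulfVK // mul1r.
rewrite -(@eqrXn2 _ 2) // -!mulrA -mulrN !normC2_rect ?rpredN //.
by rewrite sqrrN.
Qed.

(** Two second-order errors add up: linearizing the power around 1, and replacing [cayley b - 1] by
    [i b]. *)
Lemma cayley_approx (b : C) v : b \is Num.real ->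
  `|cayley b ^+ v - 1 - v%:R * ('i%R * b)| <= 2 * v%:R ^+ 2 * `|b| ^+ 2.
Proof.
move=> br; have d1 := cayley_den br.
have d0 : 1 - 'i%R * b / 2 != 0.
  by rewrite -normr_eq0 gt_eqF // (lt_le_trans ltr01).
have d2 : 2 - 'i%R * b != 0.
  have -> : 2 - 'i%R * b = 2 * (1 - 'i%R * b / 2) by field.
  by rewrite mulf_neq0 // pnatr_eq0.
have e1 : cayley b - 1 = 'i%R * b / (1 - 'i%R * b / 2).
  by rewrite /cayley; field.
have e2 : cayley b - 1 - 'i%R * b = ('i%R * b) ^+ 2 / 2 / (1 - 'i%R * b / 2).
  by rewrite /cayley; field.
have divle (t : C) : 0 <= t -> t / `|1 - 'i%R * b / 2| <= t.
  by move=> t0; rewrite ler_pdivrMr ?(lt_le_trans ltr01) // ler_peMr.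
have n1 : `|cayley b - 1| <= `|b|.
  by rewrite e1 !normrM normfV normCi mul1r divle.
have n2 : `|cayley b - 1 - 'i%R * b| <= `|b| ^+ 2.
  rewrite e2 normrM normfV (le_trans (divle _ _)) // normrM normrX normrM normCi mul1r.
  rewrite [`|2^-1|]ger0_norm ?invr_ge0 // ler_piMr ?exprn_ge0 // invf_le1 ?ltr0n //.
  by rewrite ler1n.
have -> : cayley b ^+ v - 1 - v%:R * ('i%R * b) =
   (cayley b ^+ v - 1 - v%:R * (cayley b - 1)) + v%:R * (cayley b - 1 - 'i%R * b).
  by ring.
have -> : 2 * v%:R ^+ 2 * `|b| ^+ 2 =
    v%:R ^+ 2 * `|b| ^+ 2 + v%:R ^+ 2 * `|b| ^+ 2 by ring.
rewrite (le_trans (ler_normD _ _)) // lerD //.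
  rewrite (le_trans (expr_linear_approx _ _)) ?cayley_norm //.
  by rewrite ler_wpM2l ?exprn_ge0 // ler_pXn2r ?nnegrE.
rewrite normrM normr_nat ler_pM // -natrX ler_nat.
by case: v => // v; rewrite leq_pmulr.
Qed.

(** * Concentration of the phase under the random walk *)

Section Drift.
Variables (c : C) (g q : nat).
Hypotheses (c0 : 0 < c) (c1 : c <= 1) (gc : 1 <= g%:R * c) (q0 : (0 < q)%N).

(** [V] is the number of moments compared, [1 / L] the scale of the angles and [m] the number of
    steps; the integer [g] stands in for [1 / c]. They are tuned so that the final errors add up to
    exactly [V * (m / q - 2)]. *)
Let V := (8 * q)%N.
Let L := (4 * q * (54 * g * V ^ 2))%N.
Let m := (2 * q * (2 * g * V * L + 2))%N.
(** The outcome decides the sign of the unit kick. The common offset [2 * c] makes the first-order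
    change of the moments a multiple of their second difference. *)
Let w (r : 'I_2) := cayley ((2 * c - (-1) ^+ r) / L%:R).

Let g0 : (0 < g)%N.
Proof. by case: (posnP g) gc => // ->; rewrite mul0r ler10. Qed.

Let V0 : (0 < V)%N.
Proof. by rewrite muln_gt0. Qed.

Let Ln : L%:R != 0 :> C.
Proof. by rewrite pnatr_eq0 -lt0n !muln_gt0 q0 g0 ?expn_gt0 ?V0. Qed.

(** The constant 18 is [2 * 3 ^ 2]: the factor 2 of [cayley_approx] and angles of modulus at most
    [3 / L]. *)
Lemma drift_step v :
  `|(w 0 ^+ v + w 1 ^+ v) / 2 - 1 - v%:R * 'i%R * (2 * c / L%:R)| <=
     18 * v%:R ^+ 2 / L%:R ^+ 2 /\
  `|(w 0 ^+ v - w 1 ^+ v) / 2 + v%:R * 'i%R / L%:R| <=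
     18 * v%:R ^+ 2 / L%:R ^+ 2.
Proof.
have cr : c \is Num.real := gtr0_real c0.
have nr n : n%:R \is @Num.real C by apply: realn.
pose b r : C := (2 * c - (-1) ^+ r) / L%:R.
have br (r : 'I_2) : b r \is Num.real.
  by rewrite !(rpredM, rpredB, rpredV, rpredX, rpredN, rpred1) // rpredX ?rpredN ?rpred1.
have bL (r : 'I_2) : `|b r| <= 3 / L%:R.
  rewrite normrM normfV normr_nat ler_wpM2r ?invr_ge0 //.
  rewrite (le_trans (ler_normB _ _)) // normrX normrN1 expr1n ger0_norm ?mulr_ge0 ?(ltW c0) //.
  have -> : 3 = 2 + 1 :> C by rewrite natr1.
  by rewrite lerD2r ler_piMr.
pose e (r : 'I_2) := w r ^+ v - 1 - v%:R * ('i%R * b r).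
have eE (r : 'I_2) : `|e r| <= 18 * v%:R ^+ 2 / L%:R ^+ 2.
  rewrite (le_trans (cayley_approx _ (br r))) //.
  have -> : 18 * v%:R ^+ 2 / L%:R ^+ 2 = 2 * v%:R ^+ 2 * (3 / L%:R) ^+ 2 :> C by rewrite exprMn exprVn; ring.
  by rewrite ler_wpM2l ?mulr_ge0 ?exprn_ge0 // ler_pXn2r ?nnegrE ?divr_ge0.
have half (x y : C) t : `|x| <= t -> `|y| <= t -> `|(x + y) / 2| <= t.
  move=> xt yt; rewrite normrM normfV normr_nat ler_pdivrMr ?ltr0n //.
  by rewrite mulr_natr mulr2n (le_trans (ler_normD _ _)) // lerD.
have E0 : w 0 ^+ v = 1 + v%:R * ('i%R * b 0) + e 0 by rewrite /e; ring.
have E1 : w 1 ^+ v = 1 + v%:R * ('i%R * b 1) + e 1 by rewrite /e; ring.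
have b0 : b 0 = (2 * c - 1) / L%:R by rewrite /b expr0.
have b1 : b 1 = (2 * c + 1) / L%:R by rewrite /b expr1 opprK.
split.
  have -> : (w 0 ^+ v + w 1 ^+ v) / 2 - 1 - v%:R * 'i%R * (2 * c / L%:R) =
     (e 0 + e 1) / 2.
    by rewrite E0 E1 b0 b1; field.
  exact: half.
have -> : (w 0 ^+ v - w 1 ^+ v) / 2 + v%:R * 'i%R / L%:R = (e 0 + - e 1) / 2.
  by rewrite E0 E1 b0 b1; field.
by apply: half => //; rewrite normrN.
Qed.

(** Summed over time, the increments of a moment telescope to at most 2. Hence the time sums [A v]
    have small second differences relative to [m], and [almost_harmonic] brings [A 1] close to
    [A 0 = m]. *)
Lemma moment_concentration (a : nat -> nat -> C) :
  (forall v k, (k <= m)%N -> `|a v k| <= 1) ->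
  (forall k, (k <= m)%N -> a 0 k = 1) ->
  (forall v k, (k < m)%N -> a v.+1 k.+1 =
     (w 0 ^+ v.+1 + w 1 ^+ v.+1) / 2 * a v.+1 k +
     (w 0 ^+ v.+1 - w 1 ^+ v.+1) / 2 * (c * (a v k + a v.+2 k))) ->
  `|\sum_(k < m) (a 1 k.+1 - 1)| <= m%:R / q%:R.
Proof.
move=> a1 a0 rec; pose A v := \sum_(k < m) a v k.
have gn : g%:R != 0 :> C by rewrite pnatr_eq0 -lt0n.
have qn : q%:R != 0 :> C by rewrite pnatr_eq0 -lt0n.
have Vn : V%:R != 0 :> C by rewrite pnatr_eq0 -lt0n.
have cancel1 (x y u l : C) : u != 0 -> l != 0 -> x * y = x * l / u * (u / l * y).
  by move=> u0 l0; field; rewrite ?u0 ?l0.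
have cancel2 (x y u l : C) : u != 0 -> l != 0 ->
    x * l / u * (2 + y * (54 * u ^+ 2 / l ^+ 2)) =
    2 * x * l * u^-1 + 54 * x * y / l * u.
  by move=> u0 l0; field; rewrite ?u0 ?l0.
have msum t : m%:R * t = \sum_(k < m) t :> C.
  by rewrite sumr_const card_ord mulr_natl.
(* The first-order terms cancel; the two errors of [drift_step] enter with weights 1 and 2, whence
   [54 = 18 + 36]. *)
have step v k : (k < m)%N ->
  `|v.+1%:R * 'i%R * (c / L%:R) * (a v.+2 k - a v.+1 k *+ 2 + a v k)
     + (a v.+1 k.+1 - a v.+1 k)| <= 54 * v.+1%:R ^+ 2 / L%:R ^+ 2.
  move=> km; have [e0 e1] := drift_step v.+1.
  set s := _ / 2 - 1 - _ in e0; set t := _ + _ in e1.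
  have -> : v.+1%:R * 'i%R * (c / L%:R) * (a v.+2 k - a v.+1 k *+ 2 + a v k)
     + (a v.+1 k.+1 - a v.+1 k) = s * a v.+1 k + t * c * (a v k + a v.+2 k).
    by rewrite rec // /s /t; ring.
  have kl := ltnW km.
  have -> : 54 * v.+1%:R ^+ 2 / L%:R ^+ 2 = 18 * v.+1%:R ^+ 2 / L%:R ^+ 2 * 1
      + 18 * v.+1%:R ^+ 2 / L%:R ^+ 2 * 1 * 2 :> C by ring.
  rewrite (le_trans (ler_normD _ _)) // lerD //.
    by rewrite normrM ler_pM // a1.
  rewrite !normrM ler_pM ?mulr_ge0 //.
    by rewrite ler_pM // ger0_norm // ltW.
  by rewrite (le_trans (ler_normD _ _)) // [2]mulr2n lerD // a1.
have Abound v : `|A v| <= m%:R.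
  rewrite (le_trans (ler_norm_sum _ _ _)) // -[m%:R]mulr1 msum.
  by rewrite ler_sum // => k _; rewrite a1 // ltnW.
(* This solves [DE] below for [|D|], with [1 / c] replaced by [g], using [1 <= v.+1] in the first
   summand and [v.+1 <= V] in the second. *)
pose eta : C := 2 * g%:R * L%:R + 54 * g%:R * m%:R * V%:R / L%:R.
have Asecond v : (v < V)%N -> `|A v.+2 - A v.+1 *+ 2 + A v| <= eta.
  move=> vV; set D := A v.+2 - _ + _.
  have v0 : v.+1%:R != 0 :> C by rewrite pnatr_eq0.
  have DE : `|v.+1%:R * 'i%R * (c / L%:R) * D| <= 2 + m%:R * (54 * v.+1%:R ^+ 2 / L%:R ^+ 2).
    pose T := \sum_(k < m) (v.+1%:R * 'i%R * (c / L%:R) * (a v.+2 k - a v.+1 k *+ 2 + a v k)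
     + (a v.+1 k.+1 - a v.+1 k)).
    have -> : v.+1%:R * 'i%R * (c / L%:R) * D = T - (a v.+1 m - a v.+1 0%N).
      rewrite /T big_split /= -mulr_sumr.
      have -> : \sum_(k < m) (a v.+1 k.+1 - a v.+1 k) = a v.+1 m - a v.+1 0%N.
        rewrite -(big_mkord xpredT (fun k => a v.+1 k.+1 - a v.+1 k)).
        exact: telescope_sumr.
      rewrite addrK; congr (_ * _).
      by rewrite /D /A -sumrMnl -sumrB -big_split.
    rewrite (le_trans (ler_normB _ _)) // [leLHS]addrC lerD //.
      by rewrite (le_trans (ler_normB _ _)) // [2]mulr2n lerD // a1.
    rewrite (le_trans (ler_norm_sum _ _ _)) // msum.
    by rewrite ler_sum // => k _; apply: step.
  have cL : `|v.+1%:R * 'i%R * (c / L%:R) * D| = v.+1%:R / L%:R * (c * `|D|).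
    rewrite !normrM normCi mulr1 normfV !normr_nat (ger0_norm (ltW c0)).
    by ring.
  rewrite (@le_trans _ _ (g%:R * (c * `|D|))) //.
    by rewrite mulrA -[leLHS]mul1r ler_wpM2r.
  have -> : g%:R * (c * `|D|) = (g%:R * L%:R / v.+1%:R) * (v.+1%:R / L%:R * (c * `|D|)).
    exact: cancel1.
  rewrite -cL (le_trans (ler_wpM2l _ DE)) ?divr_ge0 ?mulr_ge0 //.
  have -> : g%:R * L%:R / v.+1%:R * (2 + m%:R * (54 * v.+1%:R ^+ 2 / L%:R ^+ 2)) =
     2 * g%:R * L%:R * v.+1%:R^-1 + 54 * g%:R * m%:R / L%:R * v.+1%:R :> C.
    exact: (cancel2 g%:R m%:R v.+1%:R L%:R v0 Ln).
  have -> : eta = 2 * g%:R * L%:R * 1 + 54 * g%:R * m%:R / L%:R * V%:R by rewrite /eta; ring.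
  rewrite lerD // ler_wpM2l ?divr_ge0 ?mulr_ge0 ?ler_nat //.
  by rewrite invf_le1 ?ltr0n // ler1n.
have := almost_harmonic Abound Asecond.
have -> : A 0 = m%:R.
  rewrite -[m%:R]mulr1 msum.
  by apply: eq_bigr => k _; rewrite a0 // ltnW.
(* After division by [V] the three summands are [m / (4 q)], [m / (2 q) - 2] and [m / (4 q)]. *)
have -> : m%:R *+ 2 + V%:R ^+ 2 * eta = V%:R * (m%:R / q%:R - 2).
  have LE : L%:R = 4 * q%:R * (54 * g%:R * V%:R ^+ 2) :> C by rewrite -natrX -!natrM.
  have mE : m%:R = 2 * q%:R * (2 * g%:R * V%:R * L%:R + 2) :> C.
    by rewrite -!natrM -natrD -!natrM.
  have VE : V%:R = 8 * q%:R :> C by rewrite natrM.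
  rewrite /eta mE LE VE; field.
  by rewrite qn gn.
rewrite ler_pM2l ?ltr0n // lerBrDr => AE.
(* Shifting time from [k] to [k.+1] costs a boundary term of modulus at most 2, which the [- 2] in
   the bound absorbs. *)
have -> : \sum_(k < m) (a 1 k.+1 - 1) = (A 1 - m%:R) + (a 1 m - a 1 0%N).
  have -> : a 1 m - a 1 0%N = \sum_(k < m) (a 1 k.+1 - a 1 k).
    rewrite -(big_mkord xpredT (fun k => a 1 k.+1 - a 1 k)).
    by rewrite telescope_sumr.
  rewrite -[m%:R]mulr1 msum.
  rewrite -sumrB -big_split /=; apply: eq_bigr => k _.
  by ring.
rewrite (le_trans _ AE) // (le_trans (ler_normD _ _)) // lerD2l.
by rewrite (le_trans (ler_normB _ _)) // [2]mulr2n lerD // a1.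
Qed.

(** Only [2 * q <= m] is kept about the constants: it will make the single reset step negligible in
    the time average. *)
Lemma drift_concentrates : exists (w : 'I_2 -> C) (m : nat),
  [/\ forall r, `|w r| = 1, (2 * q <= m)%N &
   forall a : nat -> nat -> C,
   (forall v k, (k <= m)%N -> `|a v k| <= 1) ->
   (forall k, (k <= m)%N -> a 0 k = 1) ->
   (forall v k, (k < m)%N -> a v.+1 k.+1 =
      (w 0 ^+ v.+1 + w 1 ^+ v.+1) / 2 * a v.+1 k +
      (w 0 ^+ v.+1 - w 1 ^+ v.+1) / 2 * (c * (a v k + a v.+2 k))) ->
   `|\sum_(k < m) (a 1 k.+1 - 1)| <= m%:R / q%:R].
Proof.
exists w, m; split; [move=> r | | exact: moment_concentration].
  apply: cayley_norm; rewrite rpredM ?rpredV ?realn // rpredB //.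
    by rewrite rpredM ?realn // gtr0_real.
  by rewrite rpredX ?rpredN ?rpred1.
by rewrite /m leq_pmulr // addn2.
Qed.

End Drift.

End PhaseDynamics.

(** * Averages under linear maps *)

Section LinearMeans.
Context {C : numClosedFieldType}.

Lemma linear_mean (U V : lmodType C) (f : U -> V) : linear f ->
  forall (c : C) (n : nat) (F : 'I_n -> U),
    f (c *: \sum_i F i) = c *: \sum_i f (F i).
Proof.
move=> lf c n F.
pose g : {linear U -> V} := HB.pack f (GRing.isLinear.Build C U V *:%R f lf).
by rewrite -[f]/(g : U -> V) linearZ raddf_sum.
Qed.

Lemma ptrace1_linear m n : linear (@ptrace1 C m n).
Proof.
move=> a X Y; apply/matrixP=> p q; rewrite !mxE mulr_sumr -big_split.
by apply: eq_bigr => s _; rewrite !mxE.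
Qed.

Lemma ptrace2_linear m n : linear (@ptrace2 C m n).
Proof.
move=> a X Y; apply/matrixP=> p q; rewrite !mxE mulr_sumr -big_split.
by apply: eq_bigr => s _; rewrite !mxE.
Qed.

Lemma tensmx_linear m n (A : 'M[C]_m) : linear (fun X : 'M[C]_n => A *t X).
Proof. by move=> a X Y; apply/matrixP=> p q; rewrite !mxE; ring. Qed.

Lemma sum_unique_le1 n (b : pred 'I_n) :
  (forall i j, b i -> b j -> i = j) -> \sum_i (b i)%:R <= 1 :> C.
Proof.
move=> ub; case: (pickP b) => [i bi|b0].
  rewrite (bigD1 i) //= bi big1 ?addr0 // => j ji.
  by case bj: (b j) => //; rewrite (ub _ _ bj bi) eqxx in ji.
by rewrite big1 ?ler01 // => i _; rewrite b0.
Qed.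

End LinearMeans.

(** * The ladder with a clock and one step of its evolution *)

Section Catalyst.
Context {C : numClosedFieldType} (m : nat).

(** Clock values run from 0 to [m] and positions from 0 to [2 m], since one tick raises the position
    by at most 2. *)
Local Notation N := (m.+1 * m.*2.+1)%N.

Definition clk (p : 'I_N) : nat := (mxtens_unindex p).1.
Definition pos (p : 'I_N) : nat := (mxtens_unindex p).2.

Lemma clk_pos_inj p q : clk p = clk q -> pos p = pos q -> p = q.
Proof.
move=> /ord_inj h1 /ord_inj h2; apply: (can_inj (@mxtens_unindexK _ _)).
by rewrite [LHS]surjective_pairing [RHS]surjective_pairing h1 h2.
Qed.

Lemma clk_pos_surj k j : (k <= m)%N -> (j <= m.*2)%N ->
  exists p, clk p = k /\ pos p = j.
Proof.
rewrite -ltnS -(ltnS j) => hk hj.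
by exists (mxtens_index (Ordinal hk, Ordinal hj)); rewrite /clk /pos mxtens_indexK.
Qed.

Definition sys (x : 'I_(2 * N)) : 'I_2 := (mxtens_unindex x).1.
Definition aux (x : 'I_(2 * N)) : 'I_N := (mxtens_unindex x).2.

Lemma sysE s p : sys (mxtens_index (s, p)) = s.
Proof. by rewrite /sys mxtens_indexK. Qed.

Lemma auxE s p : aux (mxtens_index (s, p)) = p.
Proof. by rewrite /aux mxtens_indexK. Qed.

Lemma sys_aux x : mxtens_index (sys x, aux x) = x.
Proof. by rewrite /sys /aux -surjective_pairing mxtens_unindexK. Qed.

Local Arguments clk : simpl never.
Local Arguments pos : simpl never.
Local Arguments sys : simpl never.
Local Arguments aux : simpl never.

Definition lvl (x : 'I_(2 * N)) : nat := (sys x + pos (aux x))%N.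

(* Steps act on these levels only: elsewhere the clock has run out, or the
   emission could overflow the ladder, and the catalyst is reset. *)
Definition active (x : 'I_(2 * N)) := (clk (aux x) < m)%N && (pos (aux x) < m.*2.-1)%N.

(* The ladder is relabelled by one position at each tick, so that positions stay
   nonnegative; the energy is a function of [clk - lvl], hence conserved. *)
Definition link (y x : 'I_(2 * N)) :=
  [&& active x, clk (aux y) == (clk (aux x)).+1 & lvl y == (lvl x).+1].

Definition origin : 'I_N := mxtens_index (ord0, ord0).

(** The new position must be [(lvl x).+1 - s]; it fits on the ladder because activity gives
    [lvl x <= m.*2.-1]. *)
Lemma link_unique x (s : 'I_2) : active x ->
  exists p, forall q, link (mxtens_index (s, q)) x = (q == p).
Proof.
move=> ax; have /andP[ck ps] := ax.
have lx : (lvl x <= m.*2.-1)%N.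
  rewrite /lvl; case: (sys x) => -[|[|//]] /= _; first exact: ltnW.
  by rewrite add1n.
have m0 : (0 < m.*2)%N by rewrite double_gt0 (leq_ltn_trans _ ck).
have [//||p [cp pp]] := @clk_pos_surj (clk (aux x)).+1 ((lvl x).+1 - s).
  by rewrite (leq_trans (leq_subr _ _)) // -(prednK m0) ltnS.
exists p => q; rewrite /link ax /= /lvl sysE auxE.
have sl : (s <= (lvl x).+1)%N by case: s {pp} => -[|[|//]].
apply/andP/eqP => [[/eqP h1 /eqP h2]|->].
  by apply: clk_pos_inj; [rewrite h1 cp | rewrite pp /lvl -h2 addKn].
by rewrite cp pp subnKC.
Qed.

Variables (B : 'M[C]_2) (w : 'I_2 -> C) (z : C).

(** For unimodular [z], the amplitude of outcome [r] in the basis [(|0> +- z^* |1>) / sqrt 2], with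
    the phase [w r] applied once per level. *)
Definition amp (r : 'I_2) (x : 'I_(2 * N)) : C :=
  w r ^+ lvl x * ((-1) ^+ r * z) ^+ sys x / sqrtC 2.

(** Summing over the columns [t] of [B] emits a fresh qubit in the state [B *m adjmx B]. The
    operators [inr x] are the incoherent reset. *)
Definition step_kraus (i : 'I_2 * 'I_2 + 'I_(2 * N)) : 'M[C]_(2 * N) :=
  match i with
  | inl (r, t) => \matrix_(y, x) ((link y x)%:R * (B (sys y) t * amp r x))
  | inr x => (~~ active x)%:R *: delta_mx (mxtens_index (ord0, origin)) x
  end.

Local Notation E := (kraus step_kraus).
Local Notation P := (B *m adjmx B).

Definition gain (x x' : 'I_(2 * N)) := \sum_r amp r x * (amp r x')^*%R.

Lemma step_krausE (X : 'M[C]_(2 * N)) y y' :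
  E X y y' = \sum_x \sum_x' (link y x)%:R * (link y' x')%:R
       * (P (sys y) (sys y') * (gain x x' * X x x'))
    + ((y == mxtens_index (ord0, origin)) && (y' == mxtens_index (ord0, origin)))%:R
       * \sum_x (~~ active x)%:R * X x x.
Proof.
rewrite krausE big_sumType /=; congr (_ + _).
  rewrite exchange_big /=; apply: eq_bigr => x _.
  rewrite exchange_big /=; apply: eq_bigr => x' _.
  transitivity (\sum_r \sum_t step_kraus (inl (r, t)) y x * X x x'
      * (step_kraus (inl (r, t)) y' x')^*%R).
    by rewrite pair_bigA; apply: eq_bigr => -[].
  rewrite mxE /gain [_ * X x x']mulr_suml big_distrlr /= [in RHS]exchange_big mulr_sumr.
  apply: eq_bigr => r _; rewrite mulr_sumr; apply: eq_bigr => t _.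
  by rewrite !mxE !rmorphM rmorph_nat /=; ring.
rewrite mulr_sumr; apply: eq_bigr => x _.
rewrite (bigD1 x) //= [X in _ + X]big1 ?addr0 => [|k /negPf kx]; last first.
  by rewrite big1 // => k' _; rewrite !mxE kx andbF mulr0 !mul0r.
rewrite (bigD1 x) //= [X in _ + X]big1 ?addr0 => [|k /negPf kx]; last first.
  by rewrite !mxE kx andbF mulr0 conjC0 mulr0.
rewrite !mxE !eqxx !andbT rmorphM !rmorph_nat -mulnb natrM.
by case: (active x) => /=; ring.
Qed.

(** The sum has a single term if [x] is active; otherwise both sides vanish and [origin] is a
    placeholder. *)
Lemma sum_link x (s : 'I_2) : exists p : 'I_N,
  (active x -> clk p = (clk (aux x)).+1 /\ (s + pos p = (lvl x).+1)%N) /\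
  forall f : 'I_N -> C,
    \sum_q (link (mxtens_index (s, q)) x)%:R * f q = (active x)%:R * f p.
Proof.
have [ax|nax] := boolP (active x); last first.
  exists origin; split=> // f; rewrite mul0r big1 // => q _.
  by rewrite /link (negPf nax) mul0r.
have [p hp] := link_unique s ax; exists p; split=> [_|f].
  have /and3P[_ /eqP + /eqP] : link (mxtens_index (s, p)) x by rewrite hp.
  by rewrite /lvl sysE auxE.
rewrite (bigD1 p) //= hp eqxx big1 ?addr0 // => q /negPf qp.
by rewrite hp qp mul0r.
Qed.

(* [moment 0 v S] is the [v]-th Fourier coefficient of the phase distribution of
   the ladder state [S]; the offsets [a] and [b] absorb the qubit level. *)
Definition moment (a b : nat) (S : 'M[C]_N) :=
  \sum_p \sum_q ((clk p == clk q) && (a + pos p == b + pos q)%N)%:R * S p q.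

Definition total_moment (v : nat) (X : 'M[C]_(2 * N)) :=
  \sum_x \sum_x' ((clk (aux x) == clk (aux x')) && (lvl x == v + lvl x')%N)%:R
     * (gain x x' * X x x').

Definition supported (X : 'M[C]_(2 * N)) :=
  forall x x', ~~ (active x && active x') -> X x x' = 0.

(** A step raises clock and level by one in both indices, so a constraint on their differences
    passes from output to input, and the emitted qubit factors out. *)
Lemma step_moment (X : 'M[C]_(2 * N)) (s s' : 'I_2) v : supported X ->
  \sum_p \sum_q ((clk p == clk q) && (s + pos p == v + (s' + pos q))%N)%:R
     * E X (mxtens_index (s, p)) (mxtens_index (s', q))
  = P s s' * total_moment v X.
Proof.
move=> sX; rewrite mulr_sumr.
under eq_bigr => p _.
  under eq_bigr => q _.
    rewrite step_krausE !sysE.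
    rewrite [X in _ * (_ + X)](_ : _ = 0) ?addr0; last first.
      rewrite big1 ?mulr0 // => x _; case: (boolP (active x)) => ax.
        by rewrite mul0r.
      by rewrite sX ?mulr0 // negb_and ax.
    rewrite mulr_sumr.
    under eq_bigr do rewrite mulr_sumr.
    over.
  rewrite exchange_big /=.
  under eq_bigr do rewrite exchange_big /=.
  over.
rewrite exchange_big /=; apply: eq_bigr => x _.
rewrite exchange_big mulr_sumr /=; apply: eq_bigr => x' _.
have [ax|nax] := boolP (active x && active x'); last first.
  rewrite sX // !mulr0 big1 // => p _; rewrite big1 // => q _.
  by rewrite !mulr0.
have /andP[a1 a2] := ax.
transitivity (\sum_p (link (mxtens_index (s, p)) x)%:R *
   (\sum_q (link (mxtens_index (s', q)) x')%:R *
     (((clk p == clk q) && (s + pos p == v + (s' + pos q))%N)%:R *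
       (P s s' * (gain x x' * X x x'))))).
  apply: eq_bigr => p _; rewrite mulr_sumr; apply: eq_bigr => q _.
  by ring.
have [p [/(_ a1) [p1 p2] ->]] := sum_link x s.
have [q [/(_ a2) [q1 q2] ->]] := sum_link x' s'.
by rewrite a1 a2 p1 p2 q1 q2 eqSS addnS eqSS !mul1r mulrCA.
Qed.

Hypothesis w1 : forall r, `|w r| = 1.
Hypothesis z1 : `|z| = 1.
Hypothesis B1 : \tr P = 1.

(** Of the unimodular phases [w r], only the power given by the level difference survives. *)
Lemma gainE x x' v : lvl x = (v + lvl x')%N ->
  gain x x' = 2^-1 * \sum_r w r ^+ v * ((-1) ^+ r * z) ^+ sys x
    * (((-1) ^+ r * z) ^+ sys x')^*%R.
Proof.
move=> hl; rewrite /gain mulr_sumr; apply: eq_bigr => r _.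
have ww : w r ^+ lvl x' * (w r ^+ lvl x')^*%R = 1.
  by rewrite -normCK normrX w1 !expr1n.
have s2 : (sqrtC 2)^-1 * ((sqrtC 2)^-1)^*%R = 2^-1 :> C.
  by rewrite -normCK normfV ger0_norm ?sqrtC_ge0 // exprVn sqrtCK.
rewrite /amp hl exprD !rmorphM /= -s2 -[in RHS](mulr1 (w r ^+ v)) -ww.
by ring.
Qed.

Lemma unit_mulC (c : C) : `|c| = 1 -> c * c^*%R = 1.
Proof. by rewrite -normCK => ->; rewrite expr1n. Qed.

Lemma sum_phase (f : C -> C) : \sum_(r < 2) f ((-1) ^+ r) = f 1 + f (- 1).
Proof. by rewrite big_ord_recl big_ord1 expr0 expr1. Qed.

(** At equal levels the phases cancel, leaving the completeness relation of the measurement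
    basis. *)
Lemma gain_eqlvl x x' : lvl x = lvl x' -> gain x x' = (sys x == sys x')%:R.
Proof.
move=> hl; rewrite (@gainE _ _ 0) //.
under eq_bigr do rewrite expr0 mul1r.
rewrite (sum_phase (fun e => (e * z) ^+ sys x * ((e * z) ^+ sys x')^*%R)).
have zz := unit_mulC z1.
have h2 : 2^-1 * (1 + 1) = 1 :> C by rewrite mulVf ?pnatr_eq0.
case: (sys x) => -[|[|//]] hx; case: (sys x') => -[|[|//]] hx' /=;
  rewrite ?expr0 ?expr1 ?rmorphM ?rmorphN ?rmorph1 /=.
- by rewrite mulr1.
- by ring.
- by ring.
- by rewrite !mul1r mulrACA zz mulrNN !mulr1.
Qed.

(** Distinct active inputs linked to a common output share clock and level, so they differ in the
    qubit and have gain 0. The reset operators supply the identity on the inactive states. *)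
Lemma step_trace_preserving : trace_preserving E.
Proof.
apply: kraus_trace_preserving; apply/matrixP=> x x'.
rewrite summxE big_sumType /= [RHS]mxE.
rewrite [X in _ + X](_ : _ = (x == x')%:R * (~~ active x)%:R); last first.
  rewrite (bigD1 x) //= big1 ?addr0 => [|k /negPf kx]; last first.
    rewrite mxE big1 // => y _; rewrite !mxE [x == k]eq_sym kx andbF.
    by rewrite mulr0 conjC0 mul0r.
  rewrite mxE (bigD1 (mxtens_index (ord0, origin))) //= big1 ?addr0 => [|y /negPf yo].
    rewrite !mxE !eqxx mulr1 rmorph_nat [x' == x]eq_sym /=.
    by case: (active x); rewrite ?mul0r ?mulr0 ?mul1r ?mulr1.
  by rewrite !mxE yo mulr0 conjC0 mul0r.
rewrite [X in X + _](_ : _ = (x == x')%:R * (active x)%:R); last first.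
  transitivity (\sum_s \sum_q (link (mxtens_index (s, q)) x)%:R *
      ((link (mxtens_index (s, q)) x')%:R * (P s s * gain x' x))).
    under eq_bigr do rewrite mxE.
    rewrite exchange_big sum_mxtens; apply: eq_bigr => s _; apply: eq_bigr => q _.
    transitivity (\sum_r \sum_t
      (step_kraus (inl (r, t)) (mxtens_index (s, q)) x)^*%R
       * step_kraus (inl (r, t)) (mxtens_index (s, q)) x').
      by rewrite pair_bigA; apply: eq_bigr => -[r t] _; rewrite adjmxE.
    rewrite [P s s]mxE /gain big_distrlr /= exchange_big /= !mulr_sumr.
    apply: eq_bigr => r _; rewrite !mulr_sumr; apply: eq_bigr => t _.
    by rewrite !mxE sysE !rmorphM rmorph_nat /=; ring.
  have [ax|nax] := boolP (active x); last first.
    rewrite mulr0 big1 // => s _; rewrite big1 // => q _.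
    by rewrite /link (negPf nax) mul0r.
  transitivity (\sum_s (active x && active x' && (clk (aux x) == clk (aux x'))
      && (lvl x == lvl x'))%:R * (P s s * gain x' x)).
    apply: eq_bigr => s _; have [p [/(_ ax) [p1 p2] ->]] := sum_link x s.
    rewrite ax mul1r /link auxE p1 /lvl sysE auxE p2 !eqSS.
    by rewrite -!andbA.
  rewrite -mulr_sumr -mulr_suml -[\sum_s _]/(\tr P) B1 mul1r ax mulr1 /=.
  have [<-|nx] := eqVneq x x'; first by rewrite ax !eqxx gain_eqlvl // eqxx mul1r.
  case: (active x') => /=; last by rewrite mul0r.
  have [hc|] := eqVneq (clk (aux x)) (clk (aux x')); last by rewrite mul0r.
  have [hl|] := eqVneq (lvl x) (lvl x'); last by rewrite mul0r.
  rewrite gain_eqlvl // mul1r; case: eqP => // hq.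
  case/eqP: nx; rewrite -(sys_aux x) -(sys_aux x') hq.
  by congr (mxtens_index (_, _)); apply: clk_pos_inj => //;
    move: hl; rewrite /lvl hq => /addnI.
by case: (active x); rewrite /= ?mulr0 ?mulr1 ?addr0 ?add0r.
Qed.

Lemma momentSS a b S : moment a.+1 b.+1 S = moment a b S.
Proof.
by apply: eq_bigr => p _; apply: eq_bigr => q _; rewrite !addSn eqSS.
Qed.

Lemma total_moment_tens v (rho : 'M[C]_2) (S : 'M[C]_N) :
  total_moment v (rho *t S) = \sum_u \sum_u'
    rho u u' * (2^-1 * \sum_(r < 2) w r ^+ v * ((-1) ^+ r * z) ^+ u
      * (((-1) ^+ r * z) ^+ u')^*%R) * moment u (v + u') S.
Proof.
rewrite /total_moment sum_mxtens; apply: eq_bigr => u _.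
under eq_bigr do rewrite sum_mxtens.
rewrite exchange_big /=; apply: eq_bigr => u' _.
rewrite /moment mulr_sumr; apply: eq_bigr => p _.
rewrite mulr_sumr; apply: eq_bigr => q _.
rewrite !auxE tensmxE /lvl !sysE !auxE addnA.
have [hc|] := eqVneq (clk p) (clk q); last by rewrite !mul0r mulr0.
have [hl|] := eqVneq (u + pos p)%N (v + u' + pos q)%N; last by rewrite !mul0r mulr0.
rewrite (@gainE _ _ v) ?sysE //; last by rewrite /lvl !sysE !auxE addnA.
by rewrite !mul1r; ring.
Qed.

(** Diagonal entries of [rho] see the mean over the outcomes. Off-diagonal ones carry the sign
    [(-1) ^ r], hence the half difference, and shift the order of the moment by one either way. *)
Lemma total_momentS v (rho : 'M[C]_2) (S : 'M[C]_N) :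
  let M j := moment 0 j S in
  total_moment v.+1 (rho *t S) =
    (w 0 ^+ v.+1 + w 1 ^+ v.+1) / 2 * (\tr rho * M v.+1)
    + (w 0 ^+ v.+1 - w 1 ^+ v.+1) / 2
        * (z * rho 1 0 * M v + (z^*%R) * rho 0 1 * M v.+2).
Proof.
move=> M; rewrite total_moment_tens /mxtrace !big_ord_recl !big_ord0 /= !addr0.
rewrite !addn0 !addn1 !momentSS -/(M _) -/(M _) -/(M _).
have -> : lift ord0 ord0 = 1 :> 'I_2 by apply/val_inj.
rewrite -[ord0]/(0 : 'I_2) -[bump 0 0]/1%N !expr0 !expr1 !rmorphM rmorphN rmorph1.
have e : rho 1 1 = rho 1 1 * (z * z^*%R) by rewrite unit_mulC ?mulr1.
rewrite [X in _ = _ * ((_ + X) * _) + _]e /=.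
by ring.
Qed.

(** Tracing out the catalyst forces [p = q], which for [s = v + s'] is the very constraint of
    [step_moment]. *)
Lemma ptrace2_step (X : 'M[C]_(2 * N)) (s s' : 'I_2) v : supported X ->
  s = (v + s')%N :> nat -> ptrace2 (E X) s s' = P s s' * total_moment v X.
Proof.
move=> sX hs; rewrite -step_moment // mxE; apply: eq_bigr => p _.
rewrite (bigD1 p) //= big1 ?addr0 => [|q /negPf qp].
  by rewrite eqxx hs addnA eqxx mul1r.
case: andP => [[/eqP h1 /eqP h2]|_]; last by rewrite mul0r.
move: h2; rewrite hs addnA => /addnI h2.
by rewrite (clk_pos_inj h1 h2) eqxx in qp.
Qed.

Lemma ptrace1_step (X : 'M[C]_(2 * N)) v : supported X ->
  moment 0 v (ptrace1 (E X)) = total_moment v X.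
Proof.
move=> sX; rewrite -[RHS]mul1r -B1 mulr_suml.
under [RHS]eq_bigr do rewrite -step_moment //.
rewrite [RHS]exchange_big; apply: eq_bigr => p _.
rewrite [RHS]exchange_big; apply: eq_bigr => q _.
rewrite mxE mulr_sumr; apply: eq_bigr => s _; congr (_%:R * _).
by rewrite addnCA eqn_add2l.
Qed.

(** * Iterated ticks, the periodic orbit and its average *)

Variable rho : 'M[C]_2.
Hypothesis rhoD : density rho.

Definition tick (S : 'M[C]_N) : 'M[C]_N := ptrace1 (E (rho *t S)).
Definition stage k : 'M[C]_N := iter k tick (delta_mx origin origin).

Definition inside k p := (clk p == k) && (pos p <= k.*2)%N.
Definition located k (S : 'M[C]_N) :=
  forall p q, ~~ (inside k p && inside k q) -> S p q = 0.

(** For [k < m] one has [k.*2 < m.*2.-1], so no reset occurs before the clock reaches [m]. *)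
Lemma located_supported k S : (k < m)%N -> located k S -> supported (rho *t S).
Proof.
move=> km lS x x' nax; rewrite -(sys_aux x) -(sys_aux x') tensmxE lS ?mulr0 //.
apply: contra nax => /andP[/andP[/eqP c1 p1] /andP[/eqP c2 p2]].
have hk : (k.*2 < m.*2.-1)%N.
  by rewrite -ltnS prednK ?double_gt0 ?(leq_ltn_trans _ km) // -doubleS leq_double.
by rewrite /active c1 c2 km /= !(leq_ltn_trans _ hk).
Qed.

Lemma located_tick k S : (k < m)%N -> located k S -> located k.+1 (tick S).
Proof.
move=> km lS p q npq; rewrite mxE big1 // => s _.
rewrite step_krausE [X in _ + X](_ : _ = 0) ?addr0; last first.
  rewrite big1 ?mulr0 // => x _; case: (boolP (active x)) => ax; first by rewrite mul0r.
  by rewrite (located_supported km lS) ?mulr0 // negb_and ax.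
rewrite big1 // => x _; rewrite big1 // => x' _; rewrite -(sys_aux x) -(sys_aux x') tensmxE.
case lx: (link _ _); last by rewrite !mul0r.
case lx': (link _ _); last by rewrite mulr0 mul0r.
rewrite lS ?mulr0 //; apply: contra npq => /andP[/andP[/eqP c1 p1] /andP[/eqP c2 p2]].
have key (r : 'I_N) y : link (mxtens_index (s, r)) (mxtens_index (sys y, aux y)) ->
    clk (aux y) = k -> (pos (aux y) <= k.*2)%N -> inside k.+1 r.
  move=> /and3P[_ /eqP + /eqP]; rewrite /lvl !auxE !sysE => hc hl cy py.
  rewrite /inside hc cy eqxx doubleS -(leq_add2l s) hl andTb.
  rewrite (leq_trans _ (leq_addl _ _)) // ltnS.
  exact: (leq_add (leq_ord (sys y)) py).
by rewrite (key _ _ lx) ?(key _ _ lx').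
Qed.

Lemma located_stage k : (k <= m)%N -> located k (stage k).
Proof.
elim: k => [_ p q|k IH km]; last by apply: located_tick (IH (ltnW km)).
rewrite mxE; have [->|//] := eqVneq p origin; have [->|//] := eqVneq q origin.
by rewrite /inside /clk /pos mxtens_indexK.
Qed.

(** At clock [m] nothing is active, so the whole weight 1 passes through the reset. *)
Lemma stage_last : \tr (stage m) = 1 -> stage m.+1 = stage 0.
Proof.
move=> t1; apply/matrixP => p q; rewrite /= mxE.
have lm := located_stage (leqnn m).
have z0 x x' : active x -> (rho *t stage m) x x' = 0.
  move=> /andP[cx _]; rewrite -(sys_aux x) -(sys_aux x') tensmxE lm ?mulr0 //.
  by rewrite /inside; case: eqP cx => [->|//]; rewrite ltnn.
have zs : \sum_x (~~ active x)%:R * (rho *t stage m) x x = 1.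
  transitivity (\tr (rho *t stage m)); last first.
    by rewrite mxtrace_tens t1 (proj2 rhoD) mulr1.
  apply: eq_bigr => x _; case: (boolP (active x)) => ax; last by rewrite mul1r.
  by rewrite mul0r z0.
have Es s : E (rho *t stage m) (mxtens_index (s, p)) (mxtens_index (s, q)) =
    (s == ord0)%:R * ((p == origin) && (q == origin))%:R.
  rewrite step_krausE zs mulr1 big1 ?add0r => [|x _]; last first.
    rewrite big1 // => x' _; case: (boolP (active x)) => ax.
      by rewrite z0 // !mulr0.
    by rewrite /link (negPf ax) !mul0r.
  rewrite !(can_eq (@mxtens_indexK _ _)) -!pair_eqE /=.
  by case: (s == _); rewrite ?mul0r ?mul1r.
under eq_bigr do rewrite Es.
rewrite -mulr_suml big_ord_recl big_ord1 -(inj_eq val_inj) /= addr0 mul1r.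
by rewrite mxE.
Qed.

Lemma density_step (S : 'M[C]_N) : density S -> density (E (rho *t S)).
Proof.
by move=> dS; apply: kraus_density; [exact: step_trace_preserving | exact: density_tens].
Qed.

Lemma density_stage k : density (stage k).
Proof.
elim: k => [|k IH]; first exact: density_delta.
by apply/density_ptrace1/density_step.
Qed.

Definition catalyst : 'M[C]_N := m.+1%:R^-1 *: \sum_(k < m.+1) stage k.

Lemma density_catalyst : density catalyst.
Proof. by apply: density_mean => k; apply: density_stage. Qed.

Lemma tick_linear : linear tick.
Proof.
move=> a S T; rewrite /tick tensmx_linear (kraus_is_linear step_kraus).
exact: ptrace1_linear.
Qed.

(** A tick permutes the [m.+1] stages cyclically. *)
Lemma tick_catalyst : tick catalyst = catalyst.
Proof.
rewrite /catalyst (linear_mean tick_linear); congr (_ *: _).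
rewrite big_ord_recr [RHS]big_ord_recl /= addrC; congr (_ + _).
exact/stage_last/(proj2 (density_stage m)).
Qed.

Lemma moment00 S : moment 0 0 S = \tr S.
Proof.
apply: eq_bigr => p _; rewrite (bigD1 p) //= !eqxx mul1r big1 ?addr0 // => q /negPf qp.
case: andP => [[/eqP h1 /eqP h2]|_]; last by rewrite mul0r.
by rewrite (clk_pos_inj h1 h2) eqxx in qp.
Qed.

(** Each entry is dominated by the mean of two diagonal entries, and the constraint is a partial
    matching of indices, so each half sums to at most half the trace. *)
Lemma moment_le1 v S : density S -> `|moment 0 v S| <= 1.
Proof.
move=> [pS tS]; pose b p q := (clk p == clk q) && (0 + pos p == v + pos q)%N.
have step p q : `|(b p q)%:R * S p q| <= (b p q)%:R * S p p / 2 + (b p q)%:R * S q q / 2.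
  rewrite normrM normr_nat -!mulrA -mulrDr ler_wpM2l // -mulrDl.
  exact: psdmx_normr_le.
have d p : 0 <= S p p / 2 by rewrite divr_ge0 ?psdmx_diag_ge0.
rewrite (le_trans (ler_norm_sum _ _ _)) //.
rewrite (@le_trans _ _ (\sum_p \sum_q ((b p q)%:R * S p p / 2 + (b p q)%:R * S q q / 2))) //.
  apply: ler_sum => p _; rewrite (le_trans (ler_norm_sum _ _ _)) //.
  by apply: ler_sum => q _; apply: step.
under eq_bigr do rewrite big_split.
rewrite big_split /= [X in _ + X]exchange_big /=.
have half (F : 'I_N -> 'I_N -> bool) : (forall p q r, F p q -> F p r -> q = r) ->
    \sum_p \sum_q (F p q)%:R * S p p / 2 <= 2^-1.
  move=> uF; rewrite [leRHS](_ : _ = \sum_p S p p / 2); last first.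
    by rewrite -mulr_suml -[\sum_p _]/(\tr S) tS mul1r.
  apply: ler_sum => p _.
  under eq_bigr do rewrite -mulrA.
  rewrite -mulr_suml -[leRHS]mul1r ler_wpM2r //.
  by apply: (@sum_unique_le1 _ _ (F p)) => q r; apply: uF.
rewrite [leRHS](_ : _ = 2^-1 + 2^-1); last by field.
apply: lerD; [apply: (half b) | apply: (half (fun p q => b q p))];
  move=> p q r /andP[/eqP c1 /eqP p1] /andP[/eqP c2 /eqP p2].
  by apply: clk_pos_inj; [rewrite -c1 -c2 | apply: (@addnI v); rewrite -p1 -p2].
by apply: clk_pos_inj; [rewrite c1 c2 | rewrite -[LHS]add0n -[RHS]add0n p1 p2].
Qed.

Lemma moment_stageS v k : (k < m)%N ->
  moment 0 v.+1 (stage k.+1) =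
    (w 0 ^+ v.+1 + w 1 ^+ v.+1) / 2 * moment 0 v.+1 (stage k)
    + (w 0 ^+ v.+1 - w 1 ^+ v.+1) / 2
      * (z * rho 1 0 * moment 0 v (stage k) + z^*%R * rho 0 1 * moment 0 v.+2 (stage k)).
Proof.
move=> km; rewrite [stage _]/(tick (stage k)) ptrace1_step; last first.
  by apply: (located_supported km); apply: located_stage; apply: ltnW.
by rewrite total_momentS (proj2 rhoD) mul1r.
Qed.

Definition output : 'M[C]_2 := ptrace2 (E (rho *t catalyst)).

Lemma density_output : density output.
Proof. exact/density_ptrace2/density_step/density_catalyst. Qed.

Lemma densityP : density P.
Proof. by split; [exact: psdmx_gram | exact: B1]. Qed.

(** The output is the mean of [m.+1] emitted qubits: the first [m] have entries [P s s'] times a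
    moment of order [s - s'], and the one of the reset step costs at most [2 / m.+1]. *)
Lemma output_close (e : C) : 0 <= e ->
  `|\sum_(k < m) (moment 0 1 (stage k.+1) - 1)| <= m%:R * e ->
  forall s s', `|(output - P) s s'| <= e + 2 / m.+1%:R.
Proof.
move=> e0 he; pose o k := ptrace2 (E (rho *t stage k)).
have n0 : m.+1%:R != 0 :> C by rewrite pnatr_eq0.
have oE : output - P = m.+1%:R^-1 *: (\sum_(k < m) (o k - P) + (o m - P)).
  rewrite /output /catalyst.
  have lo : linear (fun S => ptrace2 (E (rho *t S))).
    move=> a S T; rewrite tensmx_linear (kraus_is_linear step_kraus).
    exact: ptrace2_linear.
  rewrite (linear_mean lo) -(big_ord_recr m (fun k => o k - P)) sumrB scalerBr.
  by rewrite sumr_const card_ord -[P *+ _]scaler_nat scalerA mulVf // scale1r.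
have oD k : density (o k) by apply/density_ptrace2/density_step/density_stage.
have ok (k : 'I_m) (s s' : 'I_2) v : s = (v + s')%N :> nat ->
    o k s s' = P s s' * moment 0 v (stage k.+1).
  move=> hs; have sX : supported (rho *t stage k).
    by apply: (located_supported (ltn_ord k)); apply/located_stage/ltnW.
  by rewrite /o (ptrace2_step sX hs) -ptrace1_step.
have bound (s s' : 'I_2) v : s = (v + s')%N :> nat -> `|(output - P) s s'| <= e + 2 / m.+1%:R.
  move=> hs; rewrite oE mxE normrM normfV normr_nat mulrC ler_pdivrMr ?ltr0n // mulrDl divfK //.
  rewrite mxE (le_trans (ler_normD _ _)) // lerD //; last first.
    rewrite mxE [(- P) s s']mxE (le_trans (ler_normB _ _)) // [2]mulr2n.
    by rewrite lerD // density_normr_le1 //; apply: densityP.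
  rewrite summxE (@le_trans _ _ (m%:R * e)) //; last first.
    by rewrite mulrC ler_wpM2l // ler_nat.
  have -> : \sum_(k < m) (o k - P) s s' = P s s' * \sum_(k < m) (moment 0 v (stage k.+1) - 1).
    rewrite mulr_sumr; apply: eq_bigr => k _.
    by rewrite mxE [X in _ + X]mxE (ok _ _ _ _ hs) mulrBr mulr1.
  rewrite normrM -[leRHS]mul1r ler_pM // ?density_normr_le1 //; first exact: densityP.
  (* Order 0 is the trace and gives no error, order 1 is the assumed bound, and a qubit has no
     higher order. *)
  case: v hs => [|[|v]] hs //.
    rewrite big1 ?normr0 ?mulr_ge0 // => k _.
    by rewrite moment00 (proj2 (density_stage _)) subrr.
  by have := ltn_ord s; rewrite hs.
move=> s s'; have [le_s|/ltnW le_s] := leqP s' s; first by apply: (@bound _ _ (s - s')%N); rewrite subnK.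
have hD : adjmx (output - P) = output - P.
  have [[/hermP hO _] _] := density_output; have [[/hermP hP _] _] := densityP.
  apply/matrixP=> i j; rewrite adjmxE mxE [(- P) j i]mxE rmorphB /= -!adjmxE hO hP.
  by rewrite [RHS]mxE [(- P) i j]mxE.
rewrite -hD adjmxE norm_conjC; apply: (@bound _ _ (s' - s)%N).
by rewrite subnK.
Qed.

End Catalyst.

(** * Covariance under diagonal Hamiltonians *)

Section Covariance.

Lemma normalmx_diag (C : numClosedFieldType) n (h : 'rV[C]_n) :
  diag_mx h \is normalmx.
Proof.
apply/normalmxP; apply/matrixP=> i j.
rewrite mul_diag_mx [RHS]mxE (bigD1 j) //= big1 ?addr0 => [|k /negPf kj].
  rewrite !mxE eqxx mulr1n [j == i]eq_sym.
  by case: eqP => [->|_]; rewrite ?mulr1n ?mulr0n ?conjC0 ?mulr0 ?mul0r // mulrC.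
by rewrite !mxE kj mulr0n mulr0.
Qed.

(* [spectralmx] need not be the identity on a diagonal matrix, but it only
   mixes indices carrying equal eigenvalues. *)
Lemma spectral_fun_diag (C : numClosedFieldType) n (f : C -> C) (h : 'rV[C]_n) :
  spectral_fun f (diag_mx h) = diag_mx (map_mx f h).
Proof.
have /orthomx_spectralP := normalmx_diag h.
rewrite /spectral_fun; move: (spectral_unit (diag_mx h)).
move: (spectralmx _) (spectral_diag _) => U d uU hE.
have UE i j : U i j * h 0 j = d 0 i * U i j.
  have : (U *m diag_mx h) i j = (diag_mx d *m U) i j.
    by rewrite {1}hE -!mulmxA mulKVmx.
  by rewrite mul_mx_diag mul_diag_mx !mxE.
rewrite -mulmxA; suff -> : diag_mx (map_mx f d) *m U = U *m diag_mx (map_mx f h).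
  by rewrite mulKmx.
apply/matrixP=> i j; rewrite mul_mx_diag mul_diag_mx !mxE.
have [->|Uij] := eqVneq (U i j) 0; first by rewrite mulr0 mul0r.
have -> : h 0 j = d 0 i by apply: (mulIf Uij); rewrite mulrC UE.
by rewrite mulrC.
Qed.

Context {R : realType}.

Lemma evolution_diag n (e : 'I_n -> R) (t : R) (X : 'M[R[i]]_n) x y :
  let H := diag_mx (\row_j (e j)%:C) in
  (evolution H t *m X *m evolution H (- t)) x y =
    cexp (- ('i * (e x - e y)%:C * t%:C)) * X x y.
Proof.
move=> H; rewrite /evolution !spectral_fun_diag mul_mx_diag mxE mul_diag_mx !mxE.
rewrite mulrAC; congr (_ * _).
have E (a s : R) : cexp (- ('i * a%:C * s%:C)) = cos (a * s) -i* sin (a * s).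
  have -> : - ('i * a%:C * s%:C) = 0 +i* (- (a * s)) by simpc.
  by rewrite /cexp /= expR0 mul1r cosN sinN.
rewrite !E mulrN cosN sinN opprK mulrBl cosB sinB.
by apply/eqP; rewrite eq_complex /=; apply/andP; split; apply/eqP; ring.
Qed.

(** The hypothesis says that each [K i] shifts the energy by a fixed amount, so the phases before
    and after agree. *)
Lemma kraus_covariant (I : finType) n (K : I -> 'M[R[i]]_n) (e : 'I_n -> R) :
  (forall i y x y' x', K i y x != 0 -> K i y' x' != 0 ->
     e y - e y' = e x - e x') ->
  covariant (diag_mx (\row_j (e j)%:C)) (kraus K).
Proof.
move=> hK rho t _; apply/matrixP=> y y'.
rewrite evolution_diag !krausE mulr_sumr; apply: eq_bigr => i _.
rewrite mulr_sumr; apply: eq_bigr => x _.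
rewrite mulr_sumr; apply: eq_bigr => x' _.
have [->|k1] := eqVneq (K i y x) 0; first by rewrite !mul0r mulr0.
have [->|k2] := eqVneq (K i y' x') 0; first by rewrite conjC0 !mulr0.
by rewrite evolution_diag (hK _ _ _ _ _ k1 k2); ring.
Qed.

End Covariance.

(** * Transforming a coherent qubit state *)

Section QubitTransformation.
Context {R : realType}.

Lemma kraus_TIO (I : finType) n (K : I -> 'M[R[i]]_n) (H : 'M[R[i]]_n) :
  trace_preserving (kraus K) -> covariant H (kraus K) -> TIO H (kraus K).
Proof. by split=> //; apply: kraus_completely_positive. Qed.

Variables (Delta : R) (rho rho' : 'M[R[i]]_2).
Hypotheses (hrho : density rho) (hrho' : density rho').

(** The minus sign matches [pauli_z], which gives level 1 the energy [- Delta / 2]. *)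
Definition ladder_hamiltonian m : 'M[R[i]]_(m.+1 * m.*2.+1) :=
  diag_mx (\row_p (Delta * ((clk p)%:R - (pos p)%:R))%:C).

Lemma total_hamiltonianE m :
  total_hamiltonian (qubit_hamiltonian Delta) (ladder_hamiltonian m) =
  diag_mx (\row_y (Delta * (2^-1 + (clk (aux y))%:R - (lvl y)%:R))%:C).
Proof.
apply/matrixP=> x y; rewrite -(sys_aux x) -(sys_aux y).
move: (sys x) (aux x) (sys y) (aux y) => s p s' p'.
rewrite mxE !tensmxE !mxE /lvl !sysE !auxE (can_eq (@mxtens_indexK _ _)) -pair_eqE /=.
have [_|_] := eqVneq s s'; last by rewrite !mul0r !mulr0 mul0r addr0 mulr0n.
have [_|_] := eqVneq p p'; last by rewrite mulr0 mulr0n mulr0 addr0.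
rewrite !mulr1n !mulr1 !mul1r.
have -> : (-1) ^+ s = (1 - 2 * s%:R)%:C :> R[i].
  by case: s => -[|[|//]] ? /=; rewrite ?expr0 ?expr1 ?mulr0 ?subr0 ?mulr1 //;
    apply/eqP; rewrite eq_complex /=; apply/andP; split; apply/eqP; ring.
by rewrite -rmorphM -rmorphD; congr (_%:C); rewrite natrD; field.
Qed.

Lemma ladder_hamiltonian_herm m : ladder_hamiltonian m \is hermsymmx.
Proof.
apply/hermP/matrixP=> p q; rewrite adjmxE !mxE eq_sym.
have [->|_] := eqVneq q p; last by rewrite !mulr0n conjC0.
by rewrite !mulr1n; apply: CrealP; rewrite complex_real.
Qed.

(** The step operators conserve energy; a reset operator has at most one nonzero entry, so its
    energy shift is fixed. *)
Lemma step_covariant m B w z :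
  covariant (total_hamiltonian (qubit_hamiltonian Delta) (ladder_hamiltonian m))
    (kraus (step_kraus (m := m) B w z)).
Proof.
rewrite total_hamiltonianE; apply: kraus_covariant => -[[r t]|j] y x y' x'.
  have key y0 x0 : step_kraus (m := m) B w z (inl (r, t)) y0 x0 != 0 ->
     Delta * (2^-1 + (clk (aux y0))%:R - (lvl y0)%:R) =
     Delta * (2^-1 + (clk (aux x0))%:R - (lvl x0)%:R).
    rewrite mxE; case l: (link y0 x0); last by rewrite mul0r eqxx.
    by move=> _; have /and3P[_ /eqP -> /eqP ->] := l; rewrite -!natr1; ring.
  by move=> /key -> /key ->.
have key y0 x0 : step_kraus (m := m) B w z (inr j) y0 x0 != 0 ->
   y0 = mxtens_index (ord0, origin m) /\ x0 = j.
  rewrite !mxE; case: andP => [[/eqP -> /eqP ->] //|_].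
  by rewrite mulr0 eqxx.
by move=> /key[-> ->] /key[-> ->]; rewrite !subrr.
Qed.

Lemma coherent_CCTIO (q : nat) : (0 < q)%N -> rho 1 0 != 0 ->
  exists out : 'M[R[i]]_2,
    [/\ density out, forall s s', `|(out - rho') s s'| <= 2 / q%:R &
        CCTIO (qubit_hamiltonian Delta) rho out].
Proof.
move=> q0 r10; pose c : R[i] := `|rho 1 0|.
have c0 : 0 < c by rewrite normr_gt0.
have c1 : c <= 1 by apply: density_normr_le1.
(* This phase turns both off-diagonal entries into the same positive [c], as the recursion of
   [drift_concentrates] requires. *)
pose z := (rho 1 0)^*%R / c.
have zrho : z * rho 1 0 = c.
  by rewrite /z mulrAC -normCKC -/c expr2 mulfK ?gt_eqF.
have z1 : `|z| = 1.
  by rewrite normrM normfV norm_conjC normr_id -/c divff ?gt_eqF.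
have zrho' : z^*%R * rho 0 1 = c.
  have [[/hermP hr _] _] := hrho.
  by rewrite -hr adjmxE -rmorphM /= zrho conj_normC.
have [g gc] : exists g : nat, 1 <= g%:R * c.
  have [r cE] : exists r : R, c = r%:C by eexists; apply: normc_def.
  have r0 : 0 < r by rewrite -ltcR -cE.
  exists (Num.bound r^-1); rewrite cE -[_%:R](rmorph_nat (real_complex R)) -rmorphM lecR.
  rewrite -ler_pdivrMr // mul1r ltW // archi_boundP // invr_ge0 ltW //.
have [w [m [w1 qm conc]]] := drift_concentrates c0 c1 gc q0.
have [B rhoB] := psdmx_factor (proj1 hrho').
have B1 : \tr (B *m adjmx B) = 1 by rewrite -rhoB (proj2 hrho').
have tp := step_trace_preserving w1 z1 B1 : trace_preserving (kraus (step_kraus (m := m) B w z)).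
exists (output m B w z rho); split.
- exact: density_output.
- move=> s s'; rewrite rhoB.
  have close : `|\sum_(k < m) (moment 0 1 (stage m B w z rho k.+1) - 1)| <= m%:R * q%:R^-1.
    apply: (conc (fun v k => moment 0 v (stage m B w z rho k))) => [v k _|k _|v k km].
    + exact/moment_le1/density_stage.
    + by rewrite moment00 (proj2 (density_stage m w1 z1 B1 hrho k)).
    + by rewrite (moment_stageS _ _ _ _ _ km) // zrho zrho' -mulrDr.
  (* The time average contributes [1 / q], and the reset [2 / m.+1 <= 1 / q] by [2 * q <= m]. *)
  rewrite (le_trans (output_close w1 z1 B1 hrho _ close s s')) ?invr_ge0 //.
  rewrite (_ : 2 / q%:R = q%:R^-1 + q%:R^-1); last by ring.
  rewrite lerD // ler_pdivrMr ?ltr0n //.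
  rewrite [leRHS]mulrC ler_pdivlMr ?ltr0n // -natrM ler_nat.
  by rewrite (leq_trans qm).
- exists (m.+1 * m.*2.+1)%N, (ladder_hamiltonian m), (catalyst m B w z rho),
    (kraus (step_kraus (m := m) B w z)); split.
  + exact: ladder_hamiltonian_herm.
  + exact: density_catalyst.
  + by apply: kraus_TIO => //; apply: step_covariant.
  + by [].
  + exact: tick_catalyst.
Qed.

End QubitTransformation.

(** * Creating coherence by a small perturbation *)

Section CoherentPerturbation.
Context {C : numClosedFieldType}.

(** An incoherent state is mixed, with small weight, with the pure state whose entries all equal
    [1 / 2]. *)
Lemma coherent_perturbation (rho : 'M[C]_2) (e : C) : density rho -> 0 < e ->
  exists rho_e : 'M[C]_2,
    [/\ density rho_e, rho_e 1 0 != 0 & trnorm (rho_e - rho) <= e].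
Proof.
move=> dr e0; have [r10|r10] := eqVneq (rho 1 0) 0; last first.
  exists rho; split=> //; rewrite subrr.
  rewrite (le_trans (@trnorm_le _ _ _ 0 _ _)) ?mulr0 ?(ltW e0) // => i j.
  by rewrite mxE normr0.
have e8 : 0 < 8 + e by rewrite addr_gt0 ?ltr0n.
(* This keeps [l <= 1], and [trnorm_le] yields [4 * 2 l = 8 e / (8 + e) <= e]. *)
pose l := e / (8 + e).
have l0 : 0 < l by rewrite divr_gt0.
have l1 : l <= 1 by rewrite ler_pdivrMr // mul1r lerDr ler0n.
pose P : 'M[C]_2 := 2^-1 *: (const_mx 1 *m adjmx (const_mx 1 : 'M[C]_(2, 1))).
have PE i j : P i j = 2^-1.
  by rewrite !mxE big_ord1 !mxE conjC1 !mulr1.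
have dP : density P.
  split; first by apply: psdmxZ; [rewrite invr_ge0 ler0n | exact: psdmx_gram].
  by rewrite /mxtrace big_ord_recl big_ord1 !PE; field.
move: P PE dP => P PE dP; exists ((1 - l) *: rho + l *: P); split.
- split.
    by apply: psdmxD; apply: psdmxZ; rewrite ?subr_ge0 ?(ltW l0) //; [case: dr | case: dP].
  by rewrite raddfD /= !linearZ /= (proj2 dr) (proj2 dP); ring.
- by rewrite mxE [_ 1 0]mxE r10 mulr0 add0r mxE PE mulf_neq0 ?gt_eqF // invr_gt0 ltr0n.
- rewrite (_ : _ - _ = l *: (P - rho)); last first.
    by apply/matrixP=> i j; rewrite !mxE; ring.
  apply: (le_trans (@trnorm_le _ _ _ (l * 2) _ _)) => [|i j|].
  + by rewrite mulr_ge0 ?(ltW l0).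
  + rewrite mxE normrM gtr0_norm // ler_wpM2l ?(ltW l0) //.
    rewrite mxE [(- rho) i j]mxE (le_trans (ler_normB _ _)) // [2]mulr2n.
    by rewrite lerD // density_normr_le1.
  + rewrite (_ : _ * _ = 8 * e / (8 + e)); last by rewrite /l; field; rewrite gt_eqF.
    by rewrite ler_pdivrMr // mulrC ler_pM2l // lerDl ltW.
Qed.

End CoherentPerturbation.

Theorem theorem2 (R : realType) (Delta : R) (hDelta : 0 < Delta)
    (rho rho' : 'M[R[i]]_2) (hrho : density rho) (hrho' : density rho')
    (eps eps' : R) (heps : 0 < eps) (heps' : 0 < eps') :
  exists rho_eps rho'_eps' : 'M[R[i]]_2,
    [/\ density rho_eps, density rho'_eps',
        trnorm (rho_eps - rho) <= eps%:C,
        trnorm (rho'_eps' - rho') <= eps'%:C &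
        CCTIO (qubit_hamiltonian Delta) rho_eps rho'_eps'].
Proof.
have [rho_e [de ne te]] : exists rho_e : 'M[R[i]]_2,
    [/\ density rho_e, rho_e 1 0 != 0 & trnorm (rho_e - rho) <= eps%:C].
  by apply: coherent_perturbation; rewrite ?ltcR.
(* For 2 by 2 matrices [trnorm_le] turns the entry bound [2 / q] into [8 / q], which is at most
   [eps']; the successor makes [q] positive. *)
pose q := (Num.bound (8 / eps')).+1.
have [out [dout close cc]] := coherent_CCTIO Delta de hrho' (ltn0Sn _ : (0 < q)%N) ne.
exists rho_e, out; split=> //.
rewrite (le_trans (trnorm_le _ close)) ?divr_ge0 //.
rewrite (_ : _ * _ = (8 / q%:R)%:C); last first.
  by rewrite rmorphM fmorphV !rmorph_nat; ring.
rewrite lecR ler_pdivrMr ?ltr0n // mulrC -ler_pdivrMr //.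
have b0 : 0 <= 8 / eps' by rewrite divr_ge0 // ltW.
by rewrite (le_trans (ltW (archi_boundP b0))) // ler_nat.
Qed.
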